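(* Let $G$ be a controllable graph of order $n$ with adjacency matrix $A$ such that $\theta(G)$ is odd. Suppose that for each multiple prime factor $p$ of $\theta(G)$ (i.e. each prime $p$ with $p^2\mid\theta(G)$) and for each (monic) multiple irreducible factor $\phi(x)$ of $\Phi_p(G;x)\in\mathbb{F}_p[x]$ (i.e. $\phi$ is irreducible over $\mathbb{F}_p$ and $\phi^2\mid\Phi_p(G;x)$), $$\min\{\operatorname{ord}_p(\det \phi(A)),\ \operatorname{ord}_p(\det \phi(A+J))\}=\deg \phi(x),$$ where in the determinants $\phi$ is regarded as a polynomial in $\mathbb{Z}[x]$ with every coefficient in $\{0,1,\ldots,p-1\}$. Then $G$ is determined by its generalized spectrum (DGS).
   Context: $G$ is a finite simple graph on $n$ vertices with adjacency matrix $A$ (a symmetric $(0,1)$-matrix); $e$ is the all-one vector and $J$ the $n\times n$ all-one matrix. The walk matrix is $W=W(G)=[e,Ae,\ldots,A^{n-1}e]$; $G$ is controllable if $\det W\neq 0$. The discriminant is $\Delta(G)=\prod_{i>j}(\alpha_i-\alpha_j)^2$, where $\alpha_1,\ldots,\alpha_n$ are the eigenvalues of $A$ (an integer). It is known that $2^{-\lfloor n/2\rfloor}\det W(G)$ is an integer, and $\theta(G)=\gcd\{2^{-\lfloor n/2\rfloor}\det W(G),\Delta(G)\}$. The generalized spectrum of $G$ is the ordered pair $(\sigma(G),\sigma(\bar G))$, where $\sigma$ denotes the multiset of adjacency eigenvalues and $\bar G$ is the complement of $G$. $G$ is DGS if every graph with the same generalized spectrum as $G$ is isomorphic to $G$.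 For a square matrix $M$, $\chi(M;x)=\det(xI-M)$. For an odd prime $p$, $\Phi_p(G;x)=\gcd\{\chi(A;x),\chi(A+J;x)\}\in\mathbb{F}_p[x]$, the gcd being taken over $\mathbb{F}_p$. For an integer $m\ne0$ and a prime $p$, $\operatorname{ord}_p(m)$ is the largest $k\ge 0$ with $p^k\mid m$; $\operatorname{ord}_p(0)=\infty$. *)

(* Defs.v *)
From mathcomp Require Import all_boot all_order all_algebra all_field.

Set Implicit Arguments.
Unset Strict Implicit.
Unset Printing Implicit Defensive.

Import Order.TTheory GRing.Theory Num.Theory.
Local Open Scope ring_scope.

Record sgraph (n : nat) := SGraph {
  edge :> rel 'I_n;
  edge_sym : symmetric edge;
  edge_irr : irreflexive edge
}.

Definition compl_rel n (G : sgraph n) : rel 'I_n :=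
  fun i j => (i != j) && ~~ G i j.

Lemma compl_rel_sym n (G : sgraph n) : symmetric (compl_rel G).
Proof. by move=> i j; rewrite /compl_rel eq_sym edge_sym. Qed.

Lemma compl_rel_irr n (G : sgraph n) : irreflexive (compl_rel G).
Proof. by move=> i; rewrite /compl_rel eqxx. Qed.

Definition complement n (G : sgraph n) : sgraph n :=
  SGraph (compl_rel_sym G) (compl_rel_irr G).

Definition isomorphic m n (G : sgraph m) (H : sgraph n) : Prop :=
  exists2 f : 'I_m -> 'I_n, bijective f & forall i j, H (f i) (f j) = G i j.

Definition adj n (G : sgraph n) : 'M[int]_n := \matrix_(i, j) (G i j)%:R.

Definition allone n : 'M[int]_n := const_mx 1.

(* Eigenvalues with multiplicity, in an arbitrary order, so that spectra are
   compared as multisets with [perm_eq]. *)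
Definition spectrum n (M : 'M[int]_n) : seq algC :=
  sval (closed_field_poly_normal (char_poly (map_mx intr M : 'M[algC]_n))).

Definition same_generalized_spectrum m n (G : sgraph m) (H : sgraph n) : bool :=
  perm_eq (spectrum (adj G)) (spectrum (adj H)) &&
  perm_eq (spectrum (adj (complement G))) (spectrum (adj (complement H))).

Definition DGS n (G : sgraph n) : Prop :=
  forall m (H : sgraph m), same_generalized_spectrum H G -> isomorphic H G.

Definition walk_mx n (G : sgraph n) : 'M[int]_n :=
  \matrix_(i, j) (adj G ^+ j *m (const_mx 1 : 'cV_n)) i 0.

Definition controllable n (G : sgraph n) : Prop := \det (walk_mx G) != 0.

Definition discriminantC n (G : sgraph n) : algC :=
  let s := spectrum (adj G) in
  \prod_(i < size s) \prod_(j < size s | (j < i)%N) (s`_i - s`_j) ^+ 2.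

(* [Num.floor] only retypes the value, which is an integer: see
   [discriminantE] below. *)
Definition discriminant n (G : sgraph n) : int := Num.floor (discriminantC G).

(* The division is exact: see [reduced_det_walkE] below. *)
Definition reduced_det_walk n (G : sgraph n) : int :=
  (\det (walk_mx G) %/ 2 ^+ (n./2))%Z.

Definition theta n (G : sgraph n) : nat :=
  gcdn `|reduced_det_walk G| `|discriminant G|.

(* Given only up to a nonzero constant, which does not affect divisibility. *)
Definition Phi (p : nat) n (G : sgraph n) : {poly 'F_p} :=
  gcdp (map_poly intr (char_poly (adj G)))
       (map_poly intr (char_poly (adj G + allone n))).

(* An element of ['F_p] is an ordinal below [p]: its underlying natural number
   is its representative in {0, ..., p - 1}. *)
Definition lift_poly (p : nat) (f : {poly 'F_p}) : {poly int} :=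
  map_poly (fun c : 'F_p => Posz (nat_of_ord c)) f.

(* [horner_mx] requires a dimension of the form [n.+1]. *)
Definition eval_mx n (f : {poly int}) (M : 'M[int]_n) : 'M[int]_n :=
  \sum_(i < size f) f`_i *: M ^+ i.

Lemma eval_mxE n (f : {poly int}) (M : 'M[int]_n.+1) :
  eval_mx f M = horner_mx M f.
Proof.
rewrite /eval_mx /horner_mx /= /horner_morph (horner_coef_wide _ (size_poly _ _)).
by apply: eq_bigr => i _; rewrite coef_map /= -mulmxE mul_scalar_mx.
Qed.

(* [None] stands for infinity. *)
Definition ord_p (p : nat) (m : int) : option nat :=
  if m == 0 then None else Some (logn p `|m|).

Definition omin (a b : option nat) : option nat :=
  match a, b with
  | Some k, Some l => Some (minn k l)
  | Some k, None => Some k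
  | None, _ => b
  end.

Lemma char_poly_spectrum n (M : 'M[int]_n) :
  char_poly (map_mx intr M : 'M[algC]_n) =
  \prod_(z <- spectrum M) ('X - z%:P).
Proof.
rewrite /spectrum; case: closed_field_poly_normal => s /= {1}->.
by rewrite (monicP (char_poly_monic _)) scale1r.
Qed.

Lemma size_spectrum n (M : 'M[int]_n) : size (spectrum M) = n.
Proof.
have := size_char_poly (map_mx intr M : 'M[algC]_n).
by rewrite char_poly_spectrum size_prod_XsubC => -[].
Qed.

Lemma det_horner_mx (F : closedFieldType) n (M : 'M[F]_n.+1) (s : seq F) p :
    char_poly M = \prod_(z <- s) ('X - z%:P) ->
  \det (horner_mx M p) = \prod_(z <- s) p.[z].
Proof.
move=> Ms; have sz_s : size s = n.+1.
  by have := size_char_poly M; rewrite Ms size_prod_XsubC => -[].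
have prodc (c : F) : \prod_(z <- s) c = c ^+ n.+1.
  by rewrite big_const_seq count_predT sz_s -Monoid.iteropE.
have detXsubC b : \det (horner_mx M ('X - b%:P)) = \prod_(z <- s) (z - b).
  rewrite rmorphB /= horner_mx_X horner_mx_C -opprB -scaleN1r detZ.
  have -> : \det (b%:M - M) = (char_poly M).[b].
    rewrite -/(horner_eval b _) -det_map_mx; congr (\det _).
    apply/matrixP=> i j; rewrite !mxE /= /horner_eval !hornerE.
    by rewrite hornerMn hornerX.
  rewrite Ms horner_prod -prodc -big_split /=.
  by apply: eq_bigr => z _; rewrite !hornerE mulN1r opprB.
have [t ->] := closed_field_poly_normal p.
set c := lead_coef p; rewrite linearZ /= rmorph_prod /= detZ.
rewrite (big_morph _ (@det_mulmx _ _) (det1 _ _)).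
under eq_bigr do rewrite detXsubC.
rewrite exchange_big /= -prodc -big_split /=.
apply: eq_bigr => z _; rewrite hornerZ horner_prod; congr (_ * _).
by apply: eq_bigr => b _; rewrite !hornerE.
Qed.

Lemma big_neq_ord (R : Type) (idx : R) (op : Monoid.com_law idx) m
    (i : 'I_m) (F : 'I_m -> R) :
  \big[op/idx]_(j < m | j != i) F j =
  op (\big[op/idx]_(j < m | (j < i)%N) F j)
     (\big[op/idx]_(j < m | (i < j)%N) F j).
Proof.
rewrite (bigID (fun j : 'I_m => (j < i)%N)) /=.
by congr (op _ _); apply: eq_bigl => j; rewrite -val_eqE /=; case: ltngtP.
Qed.

Lemma prod_diff_roots (F : closedFieldType) n (M : 'M[F]_n.+1) (s : seq F) :
    char_poly M = \prod_(z <- s) ('X - z%:P) ->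
  \prod_(i < size s) \prod_(j < size s | (j < i)%N) (s`_i - s`_j) ^+ 2 =
  (\prod_(i < size s) \prod_(j < size s | (j < i)%N) -1) *
  \det (horner_mx M (char_poly M)^`()).
Proof.
move=> Ms; rewrite (det_horner_mx _ Ms) Ms.
have -> : \prod_(z <- s) (\prod_(z <- s) ('X - z%:P))^`().[z] =
    \prod_(i < size s) (\prod_(j < size s | (j < i)%N) (s`_i - s`_j) *
                        \prod_(j < size s | (i < j)%N) (s`_i - s`_j)).
  rewrite (big_nth 0) big_mkord.
  apply: eq_bigr => i _; rewrite (big_nth 0) big_mkord (bigD1 i) //=.
  rewrite derivM derivXsubC mul1r !hornerE subrr mul0r addr0 horner_prod.
  by rewrite -big_neq_ord; apply: eq_bigr => j _; rewrite !hornerE.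
rewrite [\prod_(i < _) (_ * _)]big_split /=.
have -> : \prod_(i < size s) \prod_(j < size s | (i < j)%N) (s`_i - s`_j) =
    \prod_(i < size s) \prod_(j < size s | (j < i)%N) (s`_j - s`_i).
  by rewrite (exchange_big_dep xpredT).
rewrite -!big_split /=; apply: eq_bigr => i _.
rewrite -!big_split /=; apply: eq_bigr => j _.
by rewrite expr2 mulN1r -mulrN opprB.
Qed.

Lemma discriminantC_int n (G : sgraph n) : discriminantC G \is a Num.int.
Proof.
case: n G => [|n] G.
  by rewrite /discriminantC size_spectrum big_ord0.
rewrite /discriminantC (prod_diff_roots (char_poly_spectrum _)) rpredM //.
  rewrite rpred_prod // => i _; rewrite rpred_prod // => j _.
  by rewrite rpredN rpred1.
by rewrite -map_char_poly deriv_map -map_horner_mx det_map_mx rpred_int.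
Qed.

Lemma discriminantE n (G : sgraph n) : (discriminant G)%:~R = discriminantC G.
Proof. by apply/eqP; rewrite -intrEfloor discriminantC_int. Qed.

Lemma adj_sym n (G : sgraph n) : (adj G)^T = adj G.
Proof. by apply/matrixP=> i j; rewrite !mxE edge_sym. Qed.

Lemma adjX_sym n (G : sgraph n) k : (adj G ^+ k)^T = adj G ^+ k.
Proof.
elim: k => [|k IH]; first by rewrite !expr0 trmx1.
by rewrite {1}exprS exprSr -!mulmxE trmx_mul IH adj_sym.
Qed.

Lemma quad_adj_even n (G : sgraph n) (x : 'cV_n) :
  (2 %| ((x^T *m (adj G *m x)) 0 0)%R)%Z.
Proof.
pose F i j := x i 0 * (G i j)%:R * x j 0.
have -> : (x^T *m (adj G *m x)) 0 0 = \sum_i \sum_j F i j.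
  rewrite mxE; apply: eq_bigr => i _; rewrite !mxE big_distrr /=.
  by apply: eq_bigr => j _; rewrite !mxE mulrA.
under eq_bigr => i _.
  rewrite (bigD1 i) //= {1}/F edge_irr mulr0 mul0r add0r.
  rewrite big_neq_ord; over.
rewrite big_split /= [X in _ + X](exchange_big_dep xpredT) //=.
rewrite -big_split rpred_sum // => i _; rewrite -big_split rpred_sum // => j _.
have -> : F j i = F i j by rewrite /F (edge_sym G j i) mulrC mulrA mulrAC.
by rewrite /= -[F i j]mulr1 -mulrDr dvdz_mull.
Qed.

Lemma walks_even n (G : sgraph n) k :
  (0 < k)%N -> (2 %| (\sum_i (adj G ^+ k *m (const_mx 1 : 'cV_n)) i 0)%R)%Z.
Proof.
set e : 'cV_n := const_mx 1.
have esum (y : 'cV_n) : \sum_i y i 0 = (e^T *m y) 0 0.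
  by rewrite mxE; apply: eq_bigr => i _; rewrite !mxE mul1r.
elim/ltn_ind: k => k IH k_gt0; pose x := adj G ^+ k./2 *m e.
have xT : x^T = e^T *m adj G ^+ k./2 by rewrite trmx_mul adjX_sym.
have [kodd | keven] := boolP (odd k).
  rewrite esum -(odd_double_half k) kodd -addnn add1n -addSn addnC exprD exprS.
  by rewrite -!mulmxE -!mulmxA mulmxA -xT quad_adj_even.
have h_gt0 : (0 < k./2)%N by case: k k_gt0 keven {IH x xT} => [|[]].
have h_lt : (k./2 < k)%N by rewrite -divn2 ltn_Pdiv.
have dk : (k = k./2 + k./2)%N by rewrite addnn even_halfK.
rewrite esum {1}dk exprD -mulmxE -mulmxA mulmxA -xT.
rewrite -[X in (_ %| X)%Z](subrK (\sum_i x i 0)%R) rpredD ?IH //.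
rewrite mxE -sumrB rpred_sum // => i _; rewrite mxE.
have -> (a : int) : a * a - a = a * (a - 1) by rewrite mulrBr mulr1.
rewrite dvdzE abszM dvdn2 oddM.
case: (x i 0) => [[|m]|m] //=; rewrite ?subn1 /=; first by case: (odd m).
by rewrite addn0; case: (odd m).
Qed.

Lemma walk_gramE n (G : sgraph n) (i j : 'I_n) :
  ((walk_mx G)^T *m walk_mx G) i j =
  \sum_l (adj G ^+ (i + j) *m (const_mx 1 : 'cV_n)) l 0.
Proof.
set e : 'cV_n := const_mx 1.
have -> : \sum_l (adj G ^+ (i + j) *m e) l 0 =
    ((adj G ^+ i *m e)^T *m (adj G ^+ j *m e)) 0 0.
  rewrite trmx_mul adjX_sym mulmxA -[_ *m _ *m adj G ^+ j]mulmxA mulmxE -exprD.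
  by rewrite -mulmxA [RHS]mxE; apply: eq_bigr => l _; rewrite !mxE mul1r.
by rewrite !mxE; apply: eq_bigr => l _; rewrite !mxE.
Qed.

Lemma det_walk_dvd n (G : sgraph n) : (2 ^+ n./2 %| \det (walk_mx G))%Z.
Proof.
case: n G => [|n] G; first exact: dvd1z.
set W := walk_mx G; set d := \det W.
pose N : 'M[int]_n.+1 :=
  \matrix_(i, j) if i == 0 then (W^T *m W) i j else ((W^T *m W) i j %/ 2)%Z.
pose c : 'rV[int]_n.+1 := \row_i if i == 0 then 1 else 2.
have WN : W^T *m W = diag_mx c *m N.
  apply/matrixP=> i j; rewrite mul_diag_mx [in RHS]mxE [N i j]mxE [c 0 i]mxE.
  case: eqVneq => [_|i_neq0]; first by rewrite mul1r.
  rewrite [in RHS]mulrC divzK // walk_gramE walks_even // addn_gt0.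
  by rewrite lt0n i_neq0.
have : (2 ^+ n %| d * d)%Z.
  have -> : d * d = \det (W^T *m W) by rewrite det_mulmx det_tr.
  rewrite WN det_mulmx det_diag big_ord_recl mxE eqxx mul1r.
  under eq_bigr do rewrite mxE.
  by rewrite prodr_const card_ord dvdz_mulr.
rewrite !dvdzE abszM !abszX /= mulnn.
have [->|d_neq0] := eqVneq d 0; first by rewrite dvdn0.
rewrite !pfactor_dvdn ?expn_gt0 ?absz_gt0 ?d_neq0 // lognX mul2n => le_n.
by rewrite leq_uphalf_double.
Qed.

Lemma reduced_det_walkE n (G : sgraph n) :
  reduced_det_walk G * 2 ^+ n./2 = \det (walk_mx G).
Proof. exact/divzK/det_walk_dvd. Qed.

(* Main.v *)
(* A graph H with the generalized spectrum of G satisfies O A = B O for a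
   rational orthogonal O fixing the all-one vector, and H is isomorphic to G as
   soon as O is integral. Otherwise some prime p admits an integer row vector v,
   nonzero modulo p, with v / p in the lattice spanned by the rows of O; then
   p divides v A^k e and p^2 divides v A^k v^T for all k, and v may be chosen
   such that v f(A) = 0 mod p for a monic lift f of an irreducible polynomial
   phi over F_p. The same holds with A + J in place of A.

   The key fact is that the characteristic polynomial of M = A, A + J then lies
   in the square of the ideal (f, p) of Z[t]. Hence phi^2 divides Phi_p, the
   number det f(M) is divisible by p^(2 deg f), and p^2 divides the
   discriminant. Moreover p^2 divides det W, and for p = 2 one even has
   2 | 2^-(n/2) det W. So p is odd, p^2 divides theta, and the hypothesis on phi
   fails. *)

(* Divisibility of the characteristic polynomial by [phi ^ 2] modulo [p] would be too weak: for t^2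
   - p and f = t, with [p] odd, det f(M) and the discriminant are divisible by [p] only once. What
   matters is that the term free of [f] carries [p ^ 2], hence the square of the ideal (f, p).

   The matrix O exists because the generalized spectrum determines all numbers e^T A^k e, which are
   the entries of the Gram matrix of W. The factor [p ^ 2] in v g(M) v^T comes from the
   orthonormality of the rows of O and from the stability of their lattice under A and J. Since v
   A^k e = 0 modulo [p], also v A^k J = 0, so v g(A + J) = v g(A) modulo [p], and one vector serves
   both matrices.

   For p = 2 the divisibility of det W by 4 gives nothing once the power of 2 has been divided out.
   The replacement is that the characteristic polynomial of A is P^2 or X P^2 modulo 2, so that an
   isotropic vector must vanish modulo 2.

   Adjugates replace inverses throughout, to remain over the integers. *)
Require Import Defs.
From mathcomp Require Import all_boot all_order all_algebra all_field.
From mathcomp Require Import ring.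

Set Implicit Arguments.
Unset Strict Implicit.
Unset Printing Implicit Defensive.

Import Order.TTheory GRing.Theory Num.Theory.
Local Open Scope ring_scope.

(** * Determinants and reduction modulo a prime *)

Section RowReplacement.
Variables (R : comNzRingType) (n : nat).

Definition set_row (j : 'I_n) (w : 'rV[R]_n) (M : 'M[R]_n) : 'M[R]_n :=
  \matrix_(i, k) if i == j then w 0 k else M i k.

(** The cofactors along row [j] do not involve row [j]. For [w = u *m M] this is Cramer's rule: the
    value is [u 0 j * \det M]. *)
Lemma det_set_row j w M : \det (set_row j w M) = (w *m \adj M) 0 j.
Proof.
rewrite (expand_det_row _ j) mxE; apply: eq_bigr => k _.
rewrite !mxE eqxx; congr (_ * (_ * \det _)).
by apply/matrixP => a b; rewrite !mxE eq_sym (negbTE (neq_lift _ _)).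
Qed.

(** Turns vanishing of [Z *m c] modulo an ideal into membership of [\det Z * c i 0], without
    inverting [Z]. *)
Lemma det_mul_col (Z : 'M[R]_n) (c : 'cV[R]_n) i :
  \det Z * c i 0 = \sum_k \adj Z i k * (Z *m c) k 0.
Proof.
have : (\adj Z *m (Z *m c)) i 0 = (\det Z *: c) i 0.
  by rewrite mulmxA mul_adj_mx mul_scalar_mx.
by rewrite !mxE => <-.
Qed.

Lemma set_row_mul_col j w M (c : 'cV[R]_n) k :
  (set_row j w M *m c) k 0 = if k == j then (w *m c) 0 0 else (M *m c) k 0.
Proof.
by rewrite !mxE; case: ifP => kj; apply: eq_bigr => l _; rewrite !mxE kj.
Qed.

End RowReplacement.

Lemma poly_dvdz (d : int) (g : {poly int}) :
  (forall i, (d %| g`_i)%Z) -> exists h, g = d%:P * h.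
Proof.
move=> dg; exists (map_poly (fun z => (z %/ d)%Z) g); apply/polyP => i.
by rewrite coefCM coef_map_id0 ?div0z // mulrC divzK.
Qed.

Section ModP.
Variable p : nat.
Hypothesis p_pr : prime p.

Lemma intr_Fp_eq0 (z : int) : (z%:~R == 0 :> 'F_p) = (p %| z)%Z.
Proof.
by rewrite -(dvdz_pcharf (pchar_Fp p_pr)).
Qed.

Lemma natr_Fp_val (c : 'F_p) : (nat_of_ord c)%:Z%:~R = c.
Proof. by rewrite -[RHS]natr_Zp. Qed.

Lemma lift_polyK : cancel (@lift_poly p) (map_poly intr).
Proof.
move=> g; apply/polyP => i; rewrite coef_map /= /lift_poly.
by rewrite coef_map_id0 // natr_Fp_val.
Qed.

Lemma mxFp_eq0 m n (M : 'M[int]_(m, n)) :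
  map_mx intr M = 0 :> 'M['F_p]_(m, n) -> exists N, M = (p%:Z) *: N.
Proof.
move=> M0; exists (map_mx (fun z => (z %/ p)%Z) M); apply/matrixP => i j.
have /matrixP/(_ i j)/eqP := M0; rewrite !mxE intr_Fp_eq0 => pM.
by rewrite mulrC divzK.
Qed.

Lemma polyFp_eq0 (f : {poly int}) :
  map_poly intr f = 0 :> {poly 'F_p} -> exists g, f = (p%:Z)%:P * g.
Proof.
move=> f0; apply: poly_dvdz => i; rewrite -intr_Fp_eq0 //.
by have /polyP/(_ i)/eqP := f0; rewrite coef_map coef0.
Qed.

Lemma mxFp_scale m n (M : 'M[int]_(m, n)) :
  map_mx intr ((p%:Z) *: M) = 0 :> 'M['F_p]_(m, n).
Proof.
apply/matrixP => i j; apply/eqP; rewrite !mxE intr_Fp_eq0.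
exact: dvdz_mulr.
Qed.

Lemma polyFp_scale (g : {poly int}) :
  map_poly intr ((p%:Z)%:P * g) = 0 :> {poly 'F_p}.
Proof.
apply/polyP => i; apply/eqP; rewrite coef_map coef0 coefCM /= intr_Fp_eq0.
exact: dvdz_mulr.
Qed.

End ModP.

Section SyntheticDivision.
Variables (R : comNzRingType) (n' : nat).
Local Notation n := n'.+1.
Variables (M : 'M[R]_n) (v : 'rV[R]_n).

(* [v (f(t) - f(M)) / (t - M)] as a polynomial in [t]. *)
Definition synth_div (f : {poly R}) : 'rV[{poly R}]_n :=
  \row_j \poly_(i < (size f).-1) (v *m horner_mx M (drop_poly i.+1 f)) 0 j.

Lemma drop_polyS i (f : {poly R}) :
  drop_poly i f = drop_poly i.+1 f * 'X + (f`_i)%:P.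
Proof.
apply/polyP => k; rewrite coefD coefMX coefC !coef_drop_poly.
by case: k => [|k]; rewrite ?add0r //= addr0 addnS addSn.
Qed.

(** The coefficient of t^i in (f(t) - f(s)) / (t - s) is [drop_poly i.+1 f] evaluated at s. It is
    zero beyond the bound in the definition, so truncation loses nothing. *)
Lemma coef_synth_div f i j :
  (synth_div f 0 j)`_i = (v *m horner_mx M (drop_poly i.+1 f)) 0 j.
Proof.
rewrite mxE coef_poly; case: ltnP => // le_i.
rewrite [drop_poly _ _](_ : _ = 0) ?rmorph0 ?mulmx0 ?mxE //.
apply/polyP => k; rewrite coef_drop_poly coef0 nth_default //.
by rewrite addnS (leq_trans (leqSpred _)) // ltnS (leq_trans le_i) // leq_addl.
Qed.

Lemma mul_char_poly_mxE (u : 'rV[{poly R}]_n) j :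
  (u *m char_poly_mx M) 0 j = 'X * u 0 j - \sum_k u 0 k * (M k j)%:P.
Proof.
rewrite mulmxBr mul_mx_scalar !mxE; congr (_ - _).
by apply: eq_bigr => k _; rewrite !mxE.
Qed.

Lemma synth_divM f :
  synth_div f *m char_poly_mx M =
  f *: map_mx polyC v - map_mx polyC (v *m horner_mx M f).
Proof.
apply/rowP => j; apply/polyP => i.
rewrite mul_char_poly_mxE coefB coefXM coef_sum.
have -> : \sum_k (synth_div f 0 k * (M k j)%:P)`_i =
          (v *m horner_mx M (drop_poly i.+1 f * 'X)) 0 j.
  rewrite rmorphM /= horner_mx_X -mulmxE mulmxA [RHS]mxE.
  by apply: eq_bigr => k _; rewrite coefMC -coef_synth_div.
have -> : drop_poly i.+1 f * 'X = drop_poly i f - (f`_i)%:P.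
  by rewrite (drop_polyS i f) addrK.
set w := v *m horner_mx M f.
(* Multiplication by t shifts the coefficients, and everything telescopes except at index 0, where
   [drop_poly 0 f] is [f] itself and the remainder [v *m horner_mx M f] appears. *)
have -> : (if i == 0%N then 0 else (synth_div f 0 j)`_i.-1) =
    (v *m horner_mx M (drop_poly i f)) 0 j - (if i == 0%N then w 0 j else 0).
  by case: i => [|i] /=; rewrite ?drop_poly0l ?subrr // coef_synth_div subr0.
rewrite rmorphB /= horner_mx_C mulmxBr mul_mx_scalar !mxE coefB coefMC coefC.
by case: (i) => [|k] /=; ring.
Qed.

End SyntheticDivision.

(** * The characteristic polynomial modulo the square of (f, p) *)

Section TwoGeneratorIdeal.
Variables (R : comNzRingType) (f c : R).

Definition in_ideal x := exists a b, x = f * a + c * b.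
Definition in_ideal_sqr x := exists a b d, x = f ^+ 2 * a + c * f * b + c ^+ 2 * d.

Lemma in_idealMl x y : in_ideal y -> in_ideal (x * y).
Proof. by case=> a [b ->]; exists (x * a), (x * b); ring. Qed.

Lemma in_ideal_sum n (a b : 'I_n -> R) :
  (forall i, in_ideal (b i)) -> in_ideal (\sum_i a i * b i).
Proof.
move=> bI; apply: big_ind => [|x y [a1 [b1 ->]] [a2 [b2 ->]]|i _].
- by exists 0, 0; ring.
- by exists (a1 + a2), (b1 + b2); ring.
- exact: in_idealMl.
Qed.

Lemma in_ideal_sqr_combine x y :
  in_ideal x -> in_ideal y -> in_ideal_sqr (f * x + c * y).
Proof.
case=> a [b ->] [a' [b' ->]].
by exists a, (b + a'), b'; ring.
Qed.

(* A unit modulo an ideal is also a unit modulo its square: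
   [(1 - i) (1 + i) = 1 - i ^+ 2]. *)
Lemma in_ideal_sqr_cancel w d x :
  in_ideal (d * w - 1) -> in_ideal_sqr (w ^+ 2 * x) -> in_ideal_sqr x.
Proof.
case=> a [b def_dw] [a1 [b1 [d1 def_x]]].
pose i := d * w - 1.
have i2 : in_ideal_sqr (i ^+ 2).
  by exists (a ^+ 2), (2%:R * a * b), (b ^+ 2); rewrite /i def_dw; ring.
case: i2 => a2 [b2 [d2 def_i2]].
(* Since [d * w] is 1 + i, the first term is (1 - i^2)^2 x, and 1 = (1 - i^2)^2 + i^2 (2 - i^2). *)
have -> : x = ((1 - i) * d) ^+ 2 * (w ^+ 2 * x)
              + i ^+ 2 * ((2%:R - i ^+ 2) * x) by rewrite /i; ring.
rewrite def_x def_i2; set z := (2%:R - _) * x; set s := _ ^+ 2.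
by exists (s * a1 + a2 * z), (s * b1 + b2 * z), (s * d1 + d2 * z); ring.
Qed.

End TwoGeneratorIdeal.

Lemma horner_mx_tr (R : comNzRingType) n (M : 'M[R]_n.+1) g :
  M^T = M -> (horner_mx M g)^T = horner_mx M g.
Proof.
move=> MT; elim/poly_ind: g => [|g c IH]; first by rewrite rmorph0 trmx0.
rewrite rmorphD rmorphM /= horner_mx_X horner_mx_C linearD /= tr_scalar_mx.
by rewrite -mulmxE trmx_mul IH MT (comm_mx_horner g (erefl (M *m M))).
Qed.

Lemma irreducible_coprimep (F : fieldType) (phi g : {poly F}) :
  irreducible_poly phi -> g != 0 -> (size g < size phi)%N -> coprimep phi g.
Proof.
move=> phi_irr g0 lt_g; rewrite irreducible_poly_coprime //.
by apply: contraL lt_g => /(dvdp_leq g0); rewrite -leqNgt.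
Qed.

(* Let [X = t - M] and let [u] be the quotient [synth_div M v f], so that
   [u X = f v - p y]. By Cramer's rule, [u_j det X = f det Z - p det Z'], where
   [Z] and [Z'] are [X] with row [j] replaced by [v] and [y]. Since [X] is
   symmetric, [Z u^T] and [Z' u^T] vanish modulo [(f, p)], hence so do
   [u_j det Z] and [u_j det Z'], and [u_j] is a unit modulo [(f, p)]. *)
Lemma char_poly_in_ideal_sqr p n (M : 'M[int]_n.+1) (v y : 'rV[int]_n.+1)
    (f : {poly int}) (phi : {poly 'F_p}) :
    prime p -> M^T = M -> f \is monic -> map_poly intr f = phi ->
    irreducible_poly phi -> map_mx intr v != 0 :> 'rV['F_p]_n.+1 ->
    v *m horner_mx M f = (p%:Z) *: y ->
    (forall g, ((p ^ 2)%N %| ((v *m horner_mx M g *m v^T) 0 0)%R)%Z) ->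
  in_ideal_sqr f (p%:Z)%:P (char_poly M).
Proof.
move=> p_pr MT f_mon f_phi phi_irr v_neq0 vf vv.
have p0 : p%:Z != 0 by rewrite -lt0n prime_gt0.
pose X := char_poly_mx M; pose u := synth_div M v f.
have XT : X^T = X by rewrite /X /char_poly_mx linearB /= tr_scalar_mx map_trmx MT.
have uX k : (u *m X) 0 k = f * (v 0 k)%:P - (p%:Z)%:P * (y 0 k)%:P.
  by rewrite synth_divM vf !mxE polyCM.
have u_coef w i : (\sum_k (map_mx polyC w 0 k * u^T k 0))`_i =
    (v *m horner_mx M (drop_poly i.+1 f) *m w^T) 0 0.
  rewrite coef_sum [RHS]mxE; apply: eq_bigr => k _.
  by rewrite [u^T k 0]mxE [map_mx _ _ _ _]mxE coefCM coef_synth_div [w^T _ _]mxE mulrC.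
have wu w : (forall g, (p %| ((v *m horner_mx M g *m w^T) 0 0)%R)%Z) ->
    in_ideal f (p%:Z)%:P ((map_mx polyC w *m u^T) 0 0).
  move=> pw; rewrite mxE.
  have [|h ->] := @poly_dvdz p (\sum_k map_mx polyC w 0 k * u^T k 0).
    by move=> i; rewrite u_coef.
  by exists 0, h; ring.
have pv g : (p %| ((v *m horner_mx M g *m v^T) 0 0)%R)%Z.
  by apply: dvdz_trans (vv g); rewrite expnS expn1 PoszM dvdz_mulr.
(* One of the two factors [p] of the hypothesis is spent here: [p] times y^T is f(M) v^T by
   symmetry, so f(M) is absorbed into the polynomial. *)
have py g : (p %| ((v *m horner_mx M g *m y^T) 0 0)%R)%Z.
  rewrite -(dvdz_mul2l p0).
  have -> : p%:Z * (v *m horner_mx M g *m y^T) 0 0 =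
            (v *m horner_mx M (g * f) *m v^T) 0 0.
    rewrite rmorphM /= -mulmxE !mulmxA -[in RHS]mulmxA.
    rewrite -[horner_mx M f in RHS](horner_mx_tr _ MT) -trmx_mul vf.
    by rewrite linearZ /= -scalemxAr !mxE.
  by have := vv (g * f); rewrite expnS expn1 PoszM.
have det_in w j : (forall g, (p %| ((v *m horner_mx M g *m w^T) 0 0)%R)%Z) ->
    in_ideal f (p%:Z)%:P (\det (set_row j (map_mx polyC w) X) * u 0 j).
  move=> pw; have -> : u 0 j = u^T j 0 by rewrite [RHS]mxE.
  rewrite det_mul_col; apply: in_ideal_sum => k; rewrite set_row_mul_col.
  case: eqP => _; first exact: wu.
  have -> : (X *m u^T) k 0 = (u *m X) 0 k by rewrite -{1}XT -trmx_mul mxE.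
  by rewrite uX; exists (v 0 k)%:P, (- (y 0 k)%:P); ring.
have [j vj] : exists j, (v 0 j)%:~R != 0 :> 'F_p.
  apply/existsP; apply: contraNT v_neq0; rewrite negb_exists => /forallP v0.
  by apply/eqP/rowP => j; rewrite !mxE; apply/eqP; have := v0 j; rewrite negbK.
have sz_f : size f = size phi.
  by rewrite -f_phi size_map_poly_id0 // (monicP f_mon) rmorph1 oner_eq0.
(* The coefficient of index deg f - 1 of [u 0 j] is [v 0 j], because [f] is monic. The degree is
   therefore below that of [phi], and [u 0 j] is nonzero modulo [p], hence coprime to [phi]. *)
have uj0 : map_poly intr (u 0 j) != 0 :> {poly 'F_p}.
  apply/eqP => /polyP/(_ (size f).-2)/eqP.
  rewrite coef_map coef_synth_div coef0 /=.
  have [sz_phi _] := phi_irr; rewrite -sz_f in sz_phi.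
  have -> : drop_poly (size f).-2.+1 f = 1.
    apply/polyP => k; rewrite coef_drop_poly coef1.
    case: k => [|k].
      by rewrite add0n -(monicP f_mon) lead_coefE; case: (size f) sz_phi => [|[]].
    rewrite nth_default //; case: (size f) sz_phi => [|[|s]] //= _.
    by rewrite addSn ltnS leq_addl.
  by rewrite rmorph1 mulmx1 (negPf vj).
have sz_uj : (size (map_poly intr (u 0 j)%R : {poly 'F_p}) < size phi)%N.
  have [sz_phi _] := phi_irr.
  rewrite (leq_ltn_trans (size_poly _ _)) // mxE (leq_ltn_trans (size_poly _ _)) //.
  by rewrite sz_f; case: (size phi) sz_phi.
have /Bezout_eq1_coprimepP[[a d] /= bez] :=
  irreducible_coprimep phi_irr uj0 sz_uj.
apply: (@in_ideal_sqr_cancel _ _ _ (u 0 j) (lift_poly d)).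
  have [|h def_h] := @polyFp_eq0 p p_pr
      (lift_poly a * f + lift_poly d * u 0 j - 1).
    rewrite rmorphB rmorphD !rmorphM rmorph1 /= !lift_polyK // f_phi. by rewrite bez subrr.
  exists (- lift_poly a), h; rewrite -def_h; ring.
have -> : u 0 j ^+ 2 * char_poly M =
    f * (\det (set_row j (map_mx polyC v) X) * u 0 j) +
    (p%:Z)%:P * (- 1 * (\det (set_row j (map_mx polyC y) X) * u 0 j)).
  have -> : char_poly M = \det X by [].
  have e1 : u 0 j * \det X = (u *m X *m \adj X) 0 j.
    by rewrite -mulmxA mul_mx_adj mul_mx_scalar [RHS]mxE mulrC.
  have e2 : (u *m X *m \adj X) 0 j =
      f * (map_mx polyC v *m \adj X) 0 j - (p%:Z)%:P * (map_mx polyC y *m \adj X) 0 j.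
    rewrite !mxE !big_distrr -sumrB; apply: eq_bigr => k _; rewrite uX !mxE /=.
    ring.
  rewrite expr2 -mulrA e1 e2 !det_set_row; ring.
by apply: in_ideal_sqr_combine; [apply: det_in | apply: in_idealMl; apply: det_in].
Qed.

(** * Integrality consequences *)

Local Notation aint := (integralOver (intr : int -> algC)).

Lemma aint_int z : aint z%:~R.
Proof. exact: (integral_id (intr : int -> algC)). Qed.

Lemma aint_sum (I : Type) (r : seq I) (P : pred I) (F : I -> algC) :
  (forall i, aint (F i)) -> aint (\sum_(i <- r | P i) F i).
Proof.
move=> intF; apply: big_ind => // [|x y]; first exact: integral0.
exact: integral_add.
Qed.

Lemma aint_prod_seq (s : seq algC) (F : algC -> algC) :
  {in s, forall z, aint (F z)} -> aint (\prod_(z <- s) F z).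
Proof.
move=> intF; rewrite big_seq; apply: big_ind => //; first exact: integral1.
by move=> x y; apply: integral_mul.
Qed.

Lemma aint_horner (f : {poly int}) z : aint z -> aint (map_poly intr f).[z].
Proof.
by apply: integral_horner; apply/integral_poly => i; rewrite coef_map; apply: aint_int.
Qed.

Lemma aint_det n (M : 'M[algC]_n) : (forall i j, aint (M i j)) -> aint (\det M).
Proof.
move=> intM; apply: aint_sum => s; apply: integral_mul.
  by rewrite -[_ ^+ _](rmorph_sign (intr : int -> algC)); apply: aint_int.
by apply: big_ind => //; [apply: integral1 | move=> x y; apply: integral_mul].
Qed.

(** A rational algebraic integer is an integer. Divisibility can thus be checked over [algC], where
    the polynomials split. *)
Lemma dvdz_aint (d m : int) : d != 0 -> aint (m%:~R / d%:~R) -> (d %| m)%Z.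
Proof.
move=> d0 [f f_mon root_f].
have /Cint_rat_Aint : m%:~R / d%:~R \in Crat by rewrite rpred_div ?rpred_int.
have /[swap]/[apply] : m%:~R / d%:~R \in Aint.
  by apply: root_monic_Aint root_f _ _; rewrite ?monic_map //; apply/polyOverP => i;
     rewrite coef_map rpred_int.
case/intrP => k def_k; apply/dvdzP; exists k; apply: (@intr_inj algC).
by rewrite rmorphM /= -def_k divfK // intr_eq0.
Qed.

Lemma aint_root (f : {poly int}) z : f \is monic -> root (map_poly intr f) z -> aint z.
Proof. by exists f. Qed.

Lemma mem_root_prod_XsubC (s : seq algC) (f : {poly algC}) z :
  f = \prod_(w <- s) ('X - w%:P) -> z \in s -> root f z.
Proof. by move=> -> sz; rewrite root_prod_XsubC. Qed.

(** The determinant is a resultant: up to sign it is the product of the characteristic polynomial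
    over the roots c of [f]. At such a root only the term p^2 h(c) survives, so each of the deg f
    factors contributes [p ^ 2] times an algebraic integer. *)
Lemma dvdz_det_horner n (M : 'M[int]_n.+1) (f : {poly int}) (p : int) :
    p != 0 -> f \is monic -> in_ideal_sqr f p%:P (char_poly M) ->
  (p ^+ (2 * (size f).-1) %| \det (horner_mx M f))%Z.
Proof.
move=> p0 f_mon [a [b [h def_chi]]].
pose fC : {poly algC} := map_poly intr f.
have fC_mon : fC \is monic by rewrite monic_map.
have [r def_fC] := closed_field_poly_normal fC.
rewrite (monicP fC_mon) scale1r in def_fC.
have sz_r : (size f).-1 = size r.
  have := size_map_poly_id0 (p := f) (f := (intr : int -> algC)).
  rewrite (monicP f_mon) oner_eq0 => /(_ isT) <-.
  by rewrite -/fC def_fC size_prod_XsubC.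
have pC0 : (p%:~R : algC) != 0 by rewrite intr_eq0.
apply: dvdz_aint; first by rewrite expf_neq0.
rewrite -det_map_mx map_horner_mx (det_horner_mx _ (char_poly_spectrum M)) -/fC.
have -> : \prod_(z <- spectrum M) fC.[z] =
    \prod_(c <- r) ((-1) ^+ n.+1 * (p%:~R ^+ 2 * (map_poly intr h).[c])).
  under eq_bigr do rewrite def_fC horner_prod.
  rewrite exchange_big /= big_seq [RHS]big_seq; apply: eq_bigr => c rc.
  have fc0 : fC.[c] = 0 by apply/eqP; apply: mem_root_prod_XsubC rc.
  have <- : (char_poly (map_mx intr M : 'M[algC]_n.+1)).[c] =
            p%:~R ^+ 2 * (map_poly intr h).[c].
    rewrite -map_char_poly def_chi !rmorphD !rmorphM /= !map_polyC /=.
    by rewrite !hornerE -/fC fc0; ring.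
  rewrite char_poly_spectrum horner_prod.
  have <- : \prod_(z <- spectrum M) (-1 : algC) = (-1) ^+ n.+1.
    by rewrite big_const_seq count_predT size_spectrum -Monoid.iteropE.
  rewrite -big_split /=; apply: eq_bigr => z _; rewrite !hornerE; ring.
under eq_bigr do rewrite mulrCA.
rewrite big_split /= rmorphXn /= exprM sz_r.
have -> : \prod_(c <- r) (p%:~R : algC) ^+ 2 = (p%:~R ^+ 2) ^+ size r.
  by rewrite big_const_seq count_predT -Monoid.iteropE.
rewrite mulrAC divff ?mul1r.
  apply: aint_prod_seq => c rc; apply: integral_mul.
    by rewrite -[_ ^+ _](rmorph_sign (intr : int -> algC)); apply: aint_int.
  apply: aint_horner; apply: aint_root f_mon _.
  by rewrite -/fC; apply: mem_root_prod_XsubC rc.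
by rewrite expf_neq0 // expf_neq0.
Qed.

Lemma dvdp_in_ideal_sqr p (chi f : {poly int}) (phi : {poly 'F_p}) :
    prime p -> map_poly intr f = phi -> in_ideal_sqr f (p%:Z)%:P chi ->
  phi ^+ 2 %| map_poly intr chi.
Proof.
move=> p_pr f_phi [a [b [h ->]]].
have -> : f ^+ 2 * a + (p%:Z)%:P * f * b + (p%:Z)%:P ^+ 2 * h =
    f ^+ 2 * a + (p%:Z)%:P * (f * b + (p%:Z)%:P * h) by ring.
by rewrite rmorphD /= polyFp_scale // addr0 rmorphM rmorphXn /= f_phi dvdp_mulr.
Qed.

(** Normalizes the cofactor of [f ^+ 2] to the quotient by [f ^+ 2], so that f q is monic of degree
    below that of [chi], as needed to index a row of a Vandermonde matrix. The remainder vanishes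
    modulo [p] by degree, so the old cofactor agrees with [q] modulo [p]; the difference goes into
    the middle term. *)
Lemma in_ideal_sqr_monic p (chi f : {poly int}) (phi : {poly 'F_p}) :
    prime p -> f \is monic -> (1 < size f)%N -> chi \is monic ->
    map_poly intr f = phi -> in_ideal_sqr f (p%:Z)%:P chi ->
  exists q b h, [/\ q \is monic, (size (f * q)%R < size chi)%N &
    chi = f ^+ 2 * q + (p%:Z)%:P * f * b + (p%:Z)%:P ^+ 2 * h].
Proof.
move=> p_pr f_mon f1 chi_mon f_phi chiI.
have phi_mon : phi \is monic by rewrite -f_phi monic_map.
have size_map_Fp (g : {poly int}) :
    g \is monic -> size (map_poly intr g : {poly 'F_p}) = size g.
  by move=> g_mon; rewrite size_map_poly_id0 // (monicP g_mon) rmorph1 oner_eq0.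
have f2_mon : f ^+ 2 \is monic by rewrite monic_exp.
have := dvdp_in_ideal_sqr p_pr f_phi chiI.
case: chiI => a [b [h def_chi]] phi2_chi.
pose q := Pdiv.Ring.rdivp chi (f ^+ 2); pose r := Pdiv.Ring.rmodp chi (f ^+ 2).
have def_r : chi = q * f ^+ 2 + r by apply: Pdiv.RingMonic.rdivp_eq.
have sz_r : (size r < size (f ^+ 2))%N by rewrite Pdiv.Ring.ltn_rmodp monic_neq0.
have sz_f2 : (size (f ^+ 2) <= size chi)%N.
  rewrite -(size_map_Fp _ f2_mon) -(size_map_Fp _ chi_mon) rmorphXn /= f_phi.
  by rewrite dvdp_leq // monic_neq0 // monic_map.
have q_mon : q \is monic.
  have : lead_coef (q * f ^+ 2) = lead_coef chi.
    rewrite [in RHS]def_r lead_coefDl //.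
    have := def_r; case: (ltnP (size r) (size (q * f ^+ 2)%R)) => // le_qr def_chi'.
    have := leq_ltn_trans (size_polyD (q * f ^+ 2) r).
    rewrite -def_chi' (maxn_idPr le_qr) => /(_ _ sz_r).
    by rewrite ltnNge sz_f2.
  by rewrite lead_coef_Mmonic // (monicP chi_mon) => /eqP.
have r0 : map_poly intr r = 0 :> {poly 'F_p}.
  apply/eqP; apply: contraTT sz_r => r0; rewrite -leqNgt.
  rewrite -(size_map_Fp _ f2_mon) rmorphXn /= f_phi.
  apply: leq_trans (_ : size (map_poly intr r : {poly 'F_p}) <= _)%N; last first.
    exact: size_poly.
  apply: dvdp_leq r0 _.
  have -> : r = chi - q * f ^+ 2 by rewrite def_r; ring.
  by rewrite rmorphB dvdp_sub // rmorphM rmorphXn /= f_phi dvdp_mull.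
have [r1 def_r1] := polyFp_eq0 p_pr r0.
have a_q : map_poly intr (a - q) = 0 :> {poly 'F_p}.
  apply/eqP; rewrite -(mulrI_eq0 _ (monic_lreg (_ : phi ^+ 2 \is monic))).
    have : f ^+ 2 * (a - q) = (p%:Z)%:P * (r1 - f * b - (p%:Z)%:P * h).
      have : f ^+ 2 * q + (p%:Z)%:P * r1 = f ^+ 2 * a + (p%:Z)%:P * f * b + (p%:Z)%:P ^+ 2 * h.
        by rewrite -def_chi def_r def_r1; ring.
      move=> e; have -> : f ^+ 2 * (a - q) = f ^+ 2 * a + (p%:Z)%:P * f * b +
         (p%:Z)%:P ^+ 2 * h - ((p%:Z)%:P * f * b + (p%:Z)%:P ^+ 2 * h) - f ^+ 2 * q by ring.
      by rewrite -e; ring.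
    move/(congr1 (map_poly (intr : int -> 'F_p))).
    by rewrite polyFp_scale // rmorphM rmorphXn /= f_phi => ->.
  by rewrite monic_exp.
have [a1 def_a1] := polyFp_eq0 p_pr a_q.
exists q, (f * a1 + b), h; split=> //.
  have : size chi = (size (f ^+ 2 * q)%R).
    have := size_polyDl (p := q * f ^+ 2) (q := r); rewrite -def_r => ->; first by rewrite mulrC.
    rewrite (leq_trans sz_r) // size_Mmonic ?monic_neq0 //.
    have : (0 < size q)%N by rewrite size_poly_gt0 monic_neq0.
    by case: (size q) => // s _; rewrite addSn leq_addl.
  move=> ->; rewrite expr2 -mulrA [(size (f * (f * q))%R)]size_monicM ?monic_neq0 ?rpredM //.
  have : (0 < size (f * q)%R)%N by rewrite size_poly_gt0 monic_neq0 ?rpredM.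
  by case: (size f) f1 => [|[|s]] // _ _; rewrite addSn addSn /= ltnS leq_addl.
by rewrite def_chi -[a in LHS](subrK q) def_a1; ring.
Qed.

Lemma discriminantC_Vandermonde n (G : sgraph n) :
  discriminantC G =
  (\det (Vandermonde n (\row_(j < n) (spectrum (adj G))`_j))) ^+ 2.
Proof.
rewrite /discriminantC det_Vandermonde size_spectrum.
under eq_bigr do rewrite prodrXl.
rewrite prodrXl; congr (_ ^+ 2).
rewrite (exchange_big_dep xpredT) //=; apply: eq_bigr => i _.
by apply: eq_bigr => j _; rewrite !mxE.
Qed.

Lemma aint_spectrum n (M : 'M[int]_n) z : z \in spectrum M -> aint z.
Proof.
move=> Mz; apply: aint_root (char_poly_monic M) _; rewrite map_char_poly.
exact: mem_root_prod_XsubC (char_poly_spectrum M) Mz.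
Qed.

(* [f(alpha) q(alpha) / p], for [alpha] an eigenvalue, is a root of
   [t ^ 2 + b(alpha) t + q(alpha) h(alpha)]. Substituting these values in the
   Vandermonde matrix for the powers of [alpha] with the exponent
   [deg (f q)] divides its determinant by [p]. *)
Lemma dvdz_discriminant n (G : sgraph n) (p : int) (f q b h : {poly int}) :
    p != 0 -> f * q \is monic -> (size (f * q)%R <= n)%N ->
    char_poly (adj G) = f ^+ 2 * q + p%:P * f * b + p%:P ^+ 2 * h ->
  (p ^+ 2 %| discriminant G)%Z.
Proof.
move=> p0 fq_mon sz_fq def_chi; set s := spectrum (adj G).
have pC0 : (p%:~R : algC) != 0 by rewrite intr_eq0.
apply: dvdz_aint; first by rewrite expf_neq0.
rewrite discriminantE discriminantC_Vandermonde -/s rmorphXn /= -expr_div_n.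
set a := \row_j _; set V := Vandermonde n a.
have a_s j : a 0 j \in s by rewrite mxE mem_nth // size_spectrum.
suff intV : aint (\det V / p%:~R) by rewrite expr2; apply: integral_mul.
have sz_gt0 : (0 < size (f * q)%R)%N by rewrite size_poly_gt0 monic_neq0.
have lt_n : ((size (f * q)%R).-1 < n)%N by rewrite prednK.
pose k := Ordinal lt_n.
pose fqC : {poly algC} := map_poly intr (f * q).
pose c : 'rV[algC]_n := \row_i (fqC`_i / p%:~R).
(* As f q is monic of degree [k], entry [k] of [c] is 1 / p, and Cramer's rule gives exactly this
   factor. *)
have -> : \det V / p%:~R = \det (set_row k (c *m V) V).
  rewrite det_set_row -mulmxA mul_mx_adj mul_mx_scalar !mxE coef_map /=.
  by rewrite -lead_coefE (monicP fq_mon) rmorph1 mul1r.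
apply: aint_det => i j; rewrite mxE; case: eqP => _; last first.
  rewrite mxE -[_ ^+ _]hornerXn -(map_polyXn (intr : int -> algC)).
  exact/aint_horner/(aint_spectrum (a_s j)).
set z := a 0 j.
have -> : (c *m V) 0 j = fqC.[z] / p%:~R.
  rewrite mxE (horner_coef_wide _ (_ : size fqC <= n)%N).
    by rewrite mulr_suml; apply: eq_bigr => l _; rewrite [c _ _]mxE [V _ _]mxE mulrAC.
  exact: leq_trans (size_poly _ _) sz_fq.
have int_z : aint z by apply: aint_spectrum (a_s j).
have chi_z : (map_poly intr (char_poly (adj G))).[z] = 0 :> algC.
  apply/eqP; rewrite map_char_poly.
  exact: mem_root_prod_XsubC (char_poly_spectrum _) (a_s j).
pose B := (map_poly intr b).[z] : algC.
pose C := (map_poly intr q).[z] * (map_poly intr h).[z] : algC.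
apply: (@integral_root_monic _ _ _ _ ('X ^+ 2 + (B *: 'X + C%:P))).
- rewrite monicE lead_coefDl ?lead_coefXn // size_polyXn.
  rewrite (leq_ltn_trans (size_polyD _ _)) // gtn_max.
  rewrite (leq_ltn_trans (size_scale_leq _ _)) ?size_polyX //=.
  by rewrite (leq_ltn_trans (size_polyC_leq1 _)).
- have quadratic (P F Q B' H : algC) : P != 0 ->
      F * F * Q + P * F * B' + P * P * H = 0 ->
      (F * Q / P) ^+ 2 + (B' * (F * Q / P) + Q * H) = 0.
    move=> P0 eq0.
    transitivity ((F * F * Q + P * F * B' + P * P * H) * (Q / P ^+ 2)).
      by field.
    by rewrite eq0 mul0r.
  rewrite /root hornerD hornerXn hornerD hornerZ hornerX hornerC.
  rewrite /fqC rmorphM hornerM; apply/eqP/quadratic => //.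
  by move: chi_z; rewrite def_chi !rmorphD !rmorphM /= !map_polyC /= !hornerE.
apply/integral_poly => m; rewrite coefD coefXn coefD coefZ coefX coefC.
apply: integral_add; first exact: integral_nat.
apply: integral_add.
  by apply: integral_mul; [apply: aint_horner | apply: integral_nat].
by case: eqP => _; [apply: integral_mul; apply: aint_horner | apply: integral0].
Qed.

(** * The walk matrix modulo p ^ 2 *)

Section Krylov.
Variables (R : comNzRingType) (n' : nat).
Local Notation n := n'.+1.
Variables (A : 'M[R]_n) (e : 'cV[R]_n).

(** The walk matrix over an arbitrary ring, so that it can be reduced modulo [p] or mapped to the
    rationals. *)
Definition krylov_mx : 'M[R]_n := \matrix_(i, j) (A ^+ j *m e) i 0.

Lemma horner_mx_sum (g : {poly R}) m : (size g <= m)%N ->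
  horner_mx A g = \sum_(i < m) g`_i *: A ^+ i.
Proof.
move=> sz_g; rewrite /horner_mx /= /horner_morph (horner_coef_wide _ (_ : _ <= m)%N).
  by apply: eq_bigr => i _; rewrite coef_map /= -mulmxE mul_scalar_mx.
exact: leq_trans (size_poly _ _) sz_g.
Qed.

Lemma krylov_mxM (g : {poly R}) : (size g <= n)%N ->
  krylov_mx *m (\col_i g`_i) = horner_mx A g *m e.
Proof.
move=> sz_g; rewrite (horner_mx_sum sz_g) mulmx_suml; apply/colP => i.
rewrite mxE summxE; apply: eq_bigr => j _.
by rewrite -scalemxAl !mxE mulrC.
Qed.

Lemma mul_krylov_mxE m (v : 'M[R]_(m, n)) i j :
  (v *m krylov_mx) i j = (v *m horner_mx A 'X^j *m e) i 0.
Proof.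
rewrite rmorphXn /= horner_mx_X -mulmxA !mxE; apply: eq_bigr => k _.
by rewrite mxE.
Qed.

End Krylov.

Lemma map_krylov_mx (R S : comNzRingType) (f : {rmorphism R -> S}) n
    (A : 'M[R]_n.+1) e :
  map_mx f (krylov_mx A e) = krylov_mx (map_mx f A) (map_mx f e).
Proof.
apply/matrixP => i j. rewrite mxE ![krylov_mx _ _ _ _]mxE.
by rewrite -rmorphXn /= -map_mxM [RHS]mxE.
Qed.

(** The left kernel of the Krylov matrix is the line of [v], and it contains [v *m A]. Its column
    space is the orthogonal complement of [v], which contains v^T because [v] is isotropic. *)
Lemma krylov_corank1 (F : fieldType) n (A : 'M[F]_n.+1) (e : 'cV_n.+1)
    (v : 'rV_n.+1) :
    v != 0 -> \rank (krylov_mx A e) = n -> (forall g, v *m horner_mx A g *m e = 0) ->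
    v *m v^T = 0 ->
  exists (l : F) nu, [/\ v *m A = l *: v, v^T = horner_mx A nu *m e & (size nu <= n)%N].
Proof.
move=> v0 rkW vge vv; set W := krylov_mx A e in rkW *.
have vgW g : v *m horner_mx A g *m W = 0.
  apply/rowP => j; rewrite mul_krylov_mxE -[v *m _ *m _]mulmxA mulmxE -rmorphM /=.
  by rewrite vge !mxE.
have vW : v *m W = 0 by have := vgW 1; rewrite rmorph1 mulmx1.
have rk_v : \rank v = 1%N by apply/eqP; rewrite eqn_leq rank_leq_row lt0n mxrank_eq0.
have ker_v : (kermx W <= v)%MS.
  rewrite -(geq_leqif (mxrank_leqif_sup _)); last exact/sub_kermxP.
  by rewrite mxrank_ker rkW rk_v subSnn.
have /sub_rVP[l vA] : (v *m A <= v)%MS.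
  apply: submx_trans ker_v; apply/sub_kermxP.
  by have := vgW 'X; rewrite horner_mx_X.
have WT_v : (v <= W^T)%MS.
  apply: (@submx_trans _ _ _ _ _ _ (kermx v^T)); first exact/sub_kermxP.
  rewrite -(geq_leqif (mxrank_leqif_sup _)).
    by rewrite mxrank_ker !mxrank_tr rkW rk_v subn1.
  by apply/sub_kermxP; rewrite -trmx_mul vW trmx0.
have [b def_v] := submxP WT_v.
have col_rV (c : 'rV[F]_n.+1) : W *m c^T = horner_mx A (rVpoly c) *m e.
  rewrite -krylov_mxM ?size_poly //; congr (_ *m _).
  by apply/colP => i; rewrite !mxE coef_rVpoly_ord.
(* A nonzero polynomial of degree at most [n] killing [e]. Reducing modulo it keeps deg nu below
   [n], which leaves room for a further factor X - l. *)
have [c c0 cW] : exists2 c : 'rV[F]_n.+1, c != 0 & horner_mx A (rVpoly c) *m e = 0.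
  have : ~~ row_free W^T by rewrite /row_free mxrank_tr rkW neq_ltn leqnn.
  rewrite -kermx_eq0 => /rowV0Pn[c /sub_kermxP cW c0]; exists c => //.
  by rewrite -col_rV -[W]trmxK -trmx_mul cW trmx0.
have k0 : rVpoly c != 0.
  by apply: contraNneq c0 => rc0; rewrite -[c]rVpolyK rc0 linear0.
exists l, (rVpoly b %% rVpoly c); split=> //.
  rewrite def_v trmx_mul trmxK col_rV {1}(divp_eq (rVpoly b) (rVpoly c)).
  by rewrite rmorphD rmorphM /= mulmxDl -mulmxE -mulmxA cW mulmx0 add0r.
by rewrite -ltnS (leq_trans _ (size_poly _ _ : size (rVpoly c) <= _)%N) // ltn_modp.
Qed.

(* Writing [v W = p y], one has [v_j det W = p det Z], where [Z] is [W] with row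
   [j] replaced by [y]. In corank 1, [v A = l v] and [v^T = nu(A) e] modulo [p],
   and the coefficients of [(X - l) nu] form a kernel vector of [Z] modulo [p]. *)
Lemma dvdz_det_krylov p n (A : 'M[int]_n.+1) (e : 'cV_n.+1) (v : 'rV_n.+1) :
    prime p -> A^T = A -> map_mx intr v != 0 :> 'rV['F_p]_n.+1 ->
    (forall g, (p %| ((v *m horner_mx A g *m e) 0 0)%R)%Z) ->
    (forall g, ((p ^ 2)%N %| ((v *m horner_mx A g *m v^T) 0 0)%R)%Z) ->
  ((p ^ 2)%N %| \det (krylov_mx A e))%Z.
Proof.
move=> p_pr AT v0 ve vv; set W := krylov_mx A e.
pose rho m k (M : 'M[int]_(m, k)) : 'M['F_p]_(m, k) := map_mx intr M.
have [y vW] : exists y, v *m W = (p%:Z) *: y.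
  apply: mxFp_eq0 => //; apply/rowP => j; rewrite mxE mul_krylov_mxE [RHS]mxE.
  by apply/eqP; rewrite intr_Fp_eq0.
have [j vj] : exists j, (v 0 j)%:~R != 0 :> 'F_p.
  apply/existsP; apply: contraNT v0; rewrite negb_exists => /forallP vj0.
  by apply/eqP/rowP => j; rewrite !mxE; apply/eqP; have := vj0 j; rewrite negbK.
pose Z := set_row j y W.
have vZ : v 0 j * \det W = p%:Z * \det Z.
  rewrite det_set_row; have := congr1 (fun u => (u *m \adj W) 0 j) vW.
  by rewrite -mulmxA mul_mx_adj mul_mx_scalar -scalemxAl !mxE mulrC.
suff pZ : (p %| \det Z)%Z.
  have : ((p ^ 2)%N %| (v 0 j * \det W)%R)%Z.
    by rewrite vZ expnS expn1 PoszM dvdz_mul.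
  rewrite Gauss_dvdzr // coprimezE /= coprimeXl // prime_coprime //.
  by move: vj; rewrite intr_Fp_eq0 // dvdzE.
rewrite -intr_Fp_eq0 // -det_map_mx -/(rho _ _ Z).
have rank_Z : (\rank (rho _ _ Z) <= (\rank (rho _ _ W)).+1)%N.
  have -> : rho _ _ Z = rho _ _ W + delta_mx j 0 *m (rho _ _ y - row j (rho _ _ W)).
    apply/matrixP => a b; rewrite !mxE big_ord1 !mxE.
    case: eqP => [->|] /=; first by rewrite mul1r addrC subrK.
    by rewrite mul0r addr0.
  rewrite -[X in (_ <= X)%N]addn1 (leq_trans (mxrank_add _ _)) // leq_add2l.
  by rewrite (leq_trans (mxrankM_maxl _ _)) // rank_leq_col.
(* [Z] is a rank-one change of [W], so in corank at least 2 it stays singular modulo [p]. *)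
have [lt_rk | ge_rk] := ltnP (\rank (rho _ _ W)) n.
  rewrite -[_ == 0]negbK -unitfE -[_ \is a _]/(rho _ _ Z \in unitmx) -row_free_unit.
  by rewrite /row_free neq_ltn (leq_ltn_trans rank_Z).
have vW0 : rho _ _ v *m rho _ _ W = 0 by rewrite -map_mxM vW mxFp_scale.
have rkW : \rank (rho _ _ W) = n.
  apply/eqP; rewrite eqn_leq ge_rk andbT -ltnS ltn_neqAle rank_leq_row andbT.
  apply: contra v0 => rkW; apply/eqP; rewrite -/(rho _ _ v).
  by apply: (row_free_inj (A := rho _ _ W) rkW); rewrite /= vW0 mul0mx.
have [|||l [nu [vA v_nu sz_nu]]] :=
  krylov_corank1 v0 (_ : \rank (krylov_mx (rho _ _ A) (rho _ _ e)) = n).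
- by rewrite -map_krylov_mx.
- move=> g; rewrite -(lift_polyK g) -map_horner_mx -!map_mxM; apply/matrixP => a b.
  by rewrite mxE [RHS]mxE !ord1; apply/eqP; rewrite intr_Fp_eq0.
- rewrite map_trmx -map_mxM; apply/matrixP => a b.
  rewrite mxE [RHS]mxE !ord1; apply/eqP; rewrite intr_Fp_eq0 //.
  have := vv 1; rewrite rmorph1 mulmx1; apply: dvdz_trans.
  by rewrite expnS PoszM dvdz_mulr.
pose L : int := nat_of_ord l; pose N := lift_poly nu.
have [y' def_y'] : exists y', v *m (A - L%:M) = (p%:Z) *: y'.
  apply: mxFp_eq0 => //; rewrite map_mxM map_mxB map_scalar_mx /= natr_Fp_val //.
  by rewrite mulmxBr vA mul_mx_scalar subrr.
have [z def_z] : exists z, v^T - horner_mx A N *m e = (p%:Z) *: z.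
  apply: mxFp_eq0 => //; rewrite map_mxB map_mxM map_horner_mx lift_polyK //.
  by rewrite -map_trmx v_nu subrr.
pose kappa := ('X - L%:P) * N.
have sz_kappa : (size kappa <= n.+1)%N.
  have sz_N : (size N <= n)%N by apply: leq_trans (size_poly _ _) _.
  rewrite (leq_trans (size_polyMleq _ _)) // size_XsubC addSn add1n.
  by rewrite ltnS.
have kappaE : horner_mx A kappa *m e = (A - L%:M) *m (v^T - (p%:Z) *: z).
  rewrite -def_z opprB [v^T + _]addrC subrK mulmxA; congr (_ *m _).
  by rewrite rmorphM rmorphB /= horner_mx_X horner_mx_C.
(* In row [j], p y kappa = v W kappa = v (A - L) (v^T - p z), where both terms are divisible by
   [p ^ 2]. In the other rows (A - L) v^T vanishes modulo [p] because [A] is symmetric. *)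
have Zk i : (p %| ((Z *m \col_i kappa`_i) i 0)%R)%Z.
  rewrite set_row_mul_col; case: eqP => _.
    have p0 : p%:Z != 0 by rewrite -lt0n prime_gt0.
    rewrite -(dvdz_mul2l p0).
    have -> : p%:Z * (y *m \col_i kappa`_i) 0 0 =
              (v *m horner_mx A ('X - L%:P) *m v^T) 0 0 - p%:Z * (p%:Z * (y' *m z) 0 0).
      transitivity ((v *m W *m (\col_i kappa`_i)) 0 0).
        by rewrite vW -scalemxAl [RHS]mxE.
      rewrite -mulmxA krylov_mxM // kappaE mulmxBr mulmxBr !mulmxA -!scalemxAr.
      rewrite def_y' rmorphB /= horner_mx_X horner_mx_C def_y' -!scalemxAl.
      by rewrite !mxE.
    rewrite rpredB //; last by rewrite mulrA; apply: dvdz_mulr.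
  rewrite krylov_mxM // kappaE.
  have -> : (A - L%:M) *m (v^T - (p%:Z) *: z) =
            (p%:Z) *: (y'^T - (A - L%:M) *m z).
    rewrite mulmxBr -scalemxAr scalerBr; congr (_ - _).
    by rewrite -linearZ /= -def_y' trmx_mul linearB /= AT tr_scalar_mx.
  by rewrite mxE dvdz_mulr.
have kappa0 : map_poly intr kappa != 0 :> {poly 'F_p}.
  rewrite rmorphM /= lift_polyK // mulf_neq0 //.
    by rewrite rmorphB /= map_polyX map_polyC polyXsubC_eq0.
  apply: contraNneq v0 => nu0; rewrite -[map_mx _ _]trmxK v_nu nu0.
  by rewrite rmorph0 mul0mx trmx0.
have [i ki] : exists i : 'I_n.+1, ~~ (p %| kappa`_i%R)%Z.
  pose m := (size (map_poly intr kappa : {poly 'F_p})).-1.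
  have lt_m : (m < n.+1)%N.
    rewrite prednK ?size_poly_gt0 //; exact: leq_trans (size_poly _ _) sz_kappa.
  exists (Ordinal lt_m); rewrite -intr_Fp_eq0 //= -[_%:~R]/((intr : int -> 'F_p) _).
  by rewrite -coef_map -lead_coefE lead_coef_eq0.
have : (p %| (\det Z * kappa`_i)%R)%Z.
  have -> : kappa`_i = (\col_i kappa`_i : 'cV_n.+1) i 0 by rewrite mxE.
  by rewrite det_mul_col rpred_sum // => k _; rewrite dvdz_mull.
rewrite dvdzE abszM Euclid_dvdM // => /orP[pZ|pk].
  by rewrite det_map_mx intr_Fp_eq0 // dvdzE.
by case/negP: ki; rewrite dvdzE.
Qed.

(** * The walk matrix modulo powers of 2 *)

Lemma poly_F2_sqr (q : {poly 'F_2}) : q \Po 'X^2 = q ^+ 2.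
Proof.
have two0 : 2%:R = 0 :> {poly 'F_2} by rewrite -[2%:R]polyCMn; apply/eqP; rewrite polyC_eq0.
have sqr_c (c : 'F_2) : c ^+ 2 = c.
  by case: c => [[|[|c]] lt_c] //; apply/val_inj.
elim/poly_ind: q => [|q c IH]; first by rewrite comp_poly0 expr0n.
rewrite comp_polyD comp_polyM comp_polyX comp_polyC IH.
have -> : (q * 'X + c%:P) ^+ 2 = q ^+ 2 * 'X^2 + (c ^+ 2)%:P + 2%:R * (q * 'X * c%:P).
  by rewrite rmorphXn /=; ring.
by rewrite two0 mul0r addr0 sqr_c.
Qed.

Lemma char_poly_skew (R : comNzRingType) n (K : 'M[R]_n) : K^T = - K ->
  char_poly K \Po (- 'X) = (-1) ^+ n *: char_poly K.
Proof.
move=> KT; rewrite /char_poly -(det_map_mx (comp_poly (- 'X))) -det_tr.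
have -> : (map_mx (comp_poly (- 'X)) (char_poly_mx K))^T = -1 *: char_poly_mx K.
  apply/matrixP => i j; have := congr1 (fun M : 'M_n => M i j) KT.
  rewrite !mxE => Kji; rewrite Kji !comp_polyB comp_polyC polyCN eq_sym.
  by rewrite rmorphMn /= comp_polyX; ring.
by rewrite detZ -mul_polyC rmorphXn /= polyCN.
Qed.

Lemma coef_comp_polyN (R : comNzRingType) (q : {poly R}) i :
  (q \Po (- 'X))`_i = (-1) ^+ i * q`_i.
Proof.
elim/poly_ind: q i => [|q c IH] i; first by rewrite comp_poly0 !coef0 mulr0.
rewrite comp_polyD comp_polyM comp_polyX comp_polyC mulrN !coefD coefN !coefMX !coefC.
case: i => [|i] /=; rewrite ?IH ?expr0 ?exprS; ring.
Qed.

(* Modulo 2, the adjacency matrix is a skew-symmetric integer matrix, whose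
   characteristic polynomial has the parity of [n]. *)
Lemma char_poly_adj_F2 n (G : sgraph n) :
  exists P : {poly 'F_2},
    map_poly intr (char_poly (adj G)) = (if odd n then 'X else 1) * P ^+ 2.
Proof.
pose U : 'M[int]_n := \matrix_(i, j) if (i < j)%N then adj G i j else 0.
pose K := U - U^T.
have KT : K^T = - K by rewrite /K linearB /= trmxK opprB.
have -> : map_poly intr (char_poly (adj G)) = map_poly intr (char_poly K) :> {poly 'F_2}.
  rewrite !map_char_poly; congr char_poly; apply/matrixP => i j; rewrite !mxE.
  rewrite (edge_sym G j i).
  have opp1 : (-1)%:~R = 1 :> 'F_2 by apply/val_inj.
  case: ltngtP => [||/val_inj->]; rewrite ?subr0 ?sub0r ?edge_irr ?subr0 //.
  by case: (G i j).
have K_coef i : odd (i + n) -> (char_poly K)`_i = 0.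
  move=> odd_in; have := congr1 (fun q : {poly int} => q`_i) (char_poly_skew KT).
  rewrite coef_comp_polyN coefZ -!(signr_odd _ i) -(signr_odd _ n).
  have -> : odd n = ~~ odd i by rewrite oddD in odd_in; case: (odd i) odd_in; case: (odd n).
  case: (odd i); rewrite ?expr0 ?expr1 ?mulN1r ?mul1r => /eqP.
    by rewrite eq_sym -addr_eq0 -mulr2n -mulr_natr mulf_eq0 orbF => /eqP.
  by rewrite -addr_eq0 -mulr2n -mulr_natr mulf_eq0 orbF => /eqP.
set q := map_poly _ _; have q_coef i : odd (i + n) -> q`_i = 0.
  by move=> odd_in; rewrite coef_map /= K_coef.
(* One of the two parts vanishes by parity; over ['F_2] the other, taken at X^2, is a square. *)
have := poly_even_odd q; rewrite !poly_F2_sqr => def_q.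
case: ifP => odd_n; [exists (odd_poly q) | exists (even_poly q)]; rewrite -[LHS]def_q.
  rewrite (_ : even_poly q = 0) ?expr0n ?add0r 1?mulrC //.
  by apply/polyP => i; rewrite coef_even_poly coef0 q_coef // oddD odd_double odd_n.
rewrite (_ : odd_poly q = 0) ?expr0n ?mul0r ?addr0 ?mul1r //.
by apply/polyP => i; rewrite coef_odd_poly coef0 q_coef // addSn /= oddD odd_double odd_n.
Qed.

(** Writing g = q P and cancelling P^2 leaves X dividing q^2, hence q, as X is irreducible. *)
Lemma dvdp_sqr_cofactor (F : fieldType) (b : bool) (P g : {poly F}) :
  P != 0 -> (if b then 'X else 1) * P ^+ 2 %| g ^+ 2 -> (if b then 'X else 1) * P %| g.
Proof.
move=> P0 dv; have : P ^+ 2 %| g ^+ 2 by apply: dvdp_trans dv; apply: dvdp_mull.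
rewrite dvdp_pexp2r // => /dvdpP[q def_g]; rewrite def_g dvdp_mul2r //.
case: b dv => [|_]; last exact: dvd1p.
rewrite def_g exprMn dvdp_mul2r ?expf_neq0 //.
have -> : 'X = 'X - 0%:P :> {poly F} by rewrite subr0.
by rewrite !dvdp_XsubCl /root !hornerE mulf_eq0 orbb.
Qed.

Lemma mulmx_inj_det (R : idomainType) n (M : 'M[R]_n) k (x y : 'M[R]_(n, k)) :
  \det M != 0 -> M *m x = M *m y -> x = y.
Proof.
move=> M0 /(congr1 (mulmx (\adj M))).
rewrite !mulmxA !mul_adj_mx !mul_scalar_mx => e.
by apply/matrixP => i j; have /matrixP/(_ i j) := e; rewrite !mxE => /(mulfI M0).
Qed.

Lemma walk_mx_krylov n (G : sgraph n.+1) :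
  walk_mx G = krylov_mx (adj G) (const_mx 1).
Proof. by apply/matrixP => i j; rewrite !mxE. Qed.

Lemma horner_mx_rVpoly_krylov (R : comNzRingType) n (A : 'M[R]_n.+1) (e : 'cV_n.+1) (b : 'cV_n.+1) :
  horner_mx A (rVpoly b^T) *m e = krylov_mx A e *m b.
Proof.
rewrite -krylov_mxM ?size_poly //; congr (_ *m _).
by apply/colP => i; rewrite !mxE coef_rVpoly_ord mxE.
Qed.

Section TwoAdic.
Variables (n : nat) (G : sgraph n.+1).
Local Notation A := (adj G).
Local Notation e := (const_mx 1 : 'cV[int]_n.+1).
Local Notation W := (walk_mx G).

(* All entries of the Gram matrix [W^T W] are even, except the first one, which
   is the order of [G]. If the reduced determinant is odd, then dividing its rows
   by [c] gives a matrix that is invertible modulo 2. *)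
Let c (i : 'I_n.+1) : int := if odd n.+1 && (i == 0) then 1 else 2.
Let T : 'M[int]_n.+1 := \matrix_(i, j) ((W^T *m W) i j %/ c i)%Z.

Lemma walk_gram_diag : W^T *m W = diag_mx (\row_i c i) *m T.
Proof.
apply/matrixP => i j; rewrite mul_diag_mx [in RHS]mxE [X in X * _]mxE [T i j]mxE.
rewrite mulrC divzK // walk_gramE /c.
case: ifP => [_|]; first exact: dvd1z.
case: (posnP (i + j)%N) => [ij0 | ij_gt0 _]; last by rewrite walks_even.
have -> /= : i == 0 by rewrite -val_eqE /=; case: (val i) ij0.
rewrite andbT ij0 expr0 mul1mx => /negbT odd_n.
under eq_bigr do rewrite mxE.
by rewrite sumr_const card_ord dvdzE dvdn2 natz.
Qed.

(** The entries of [c] multiply to the square of the power of 2 removed in [reduced_det_walk]; the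
    exceptional entry 1 in odd order accounts for the floor. *)
Lemma det_gram_cofactor : \det T = reduced_det_walk G ^+ 2.
Proof.
have c_prod : \prod_i c i = (2 ^+ n.+1./2) ^+ 2.
  rewrite -exprM muln2 big_ord_recl /c eqxx andbT.
  under eq_bigr do rewrite andbF.
  rewrite prodr_const card_ord; have := odd_double_half n.+1.
  by case: ifP => _; [rewrite add1n mul1r => -[->] | rewrite add0n -exprS => ->].
have := congr1 (fun M => \det M) walk_gram_diag.
rewrite /= !det_mulmx det_tr det_diag; under eq_bigr do rewrite mxE.
rewrite c_prod -!reduced_det_walkE => def_det.
have two0 : (2 ^+ n.+1./2 : int) ^+ 2 != 0 by rewrite !expf_neq0.
by apply: (mulfI two0); rewrite -def_det; ring.
Qed.

Hypothesis odd_red : ~~ (2 %| reduced_det_walk G)%Z.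

Let odd_T : ~~ (2 %| \det T)%Z.
Proof.
apply: contra odd_red.
by rewrite det_gram_cofactor !dvdzE abszX Euclid_dvdX // => /andP[].
Qed.

Let W_neq0 : \det W != 0.
Proof.
rewrite -reduced_det_walkE mulf_neq0 ?expf_neq0 //.
by apply: contraNneq odd_red => ->.
Qed.

Lemma c_dvd2 i : (c i %| 2)%Z.
Proof. by rewrite /c; case: ifP. Qed.

(** Each [c i] divides 2, so dividing row [i] by it leaves a factor 2 in [T *m x], and [T] is
    invertible modulo 2. *)
Lemma walk_solve k (x : 'M[int]_(n.+1, k)) :
    (forall i j, (4 %| ((W^T *m W *m x) i j)%R)%Z) ->
  forall i j, (2 %| x i j)%Z.
Proof.
move=> dx.
have [y def_y] : exists y, T *m x = 2 *: y.
  exists (\matrix_(i, j) ((T *m x) i j %/ 2)%Z); apply/matrixP => i j.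
  rewrite [in RHS]mxE [X in _ * X]mxE mulrC divzK //.
  have c0 : c i != 0 by rewrite /c; case: ifP.
  rewrite -(dvdz_mul2l c0).
  have := dx i j; rewrite walk_gram_diag -mulmxA mul_diag_mx mxE [X in X * _]mxE.
  by apply: dvdz_trans; apply: dvdz_mul (c_dvd2 i) (dvdzz 2).
move=> i j; have : (2 %| (\det T * x i j)%R)%Z.
  have := congr1 (fun M => (\adj T *m M) i j) def_y.
  by rewrite mulmxA mul_adj_mx mul_scalar_mx mxE -scalemxAr mxE => ->; apply: dvdz_mulr.
rewrite !dvdzE abszM Euclid_dvdM // => /orP[dT|//].
by case/negP: odd_T; rewrite dvdzE.
Qed.

(** The first hypothesis makes W^T v^T divisible by [c], so Cramer's rule for [T] yields integer
    coefficients of [g]. The second then says that the coefficients of g^2, reduced by the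
    characteristic polynomial, satisfy [walk_solve]. *)
Lemma walk_generate (v : 'rV[int]_n.+1) :
    (forall g, (2 %| ((v *m horner_mx A g *m e) 0 0)%R)%Z) ->
    (forall g, (4 %| ((v *m horner_mx A g *m v^T) 0 0)%R)%Z) ->
  exists2 g, \det T *: v^T = horner_mx A g *m e &
    (map_poly intr (char_poly A) : {poly 'F_2}) %| map_poly intr g ^+ 2.
Proof.
move=> ve vv.
have W_row i : (W^T *m v^T) i 0 = (v *m horner_mx A 'X^i *m e) 0 0.
  by rewrite -trmx_mul mxE walk_mx_krylov mul_krylov_mxE.
pose d : 'cV[int]_n.+1 := \col_i (((W^T *m v^T) i 0)%R %/ c i)%Z.
have def_d : W^T *m v^T = diag_mx (\row_i c i) *m d.
  apply/colP => i; rewrite mul_diag_mx [RHS]mxE [X in X * _]mxE [d i 0]mxE.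
  by rewrite mulrC divzK // (dvdz_trans (c_dvd2 i)) // W_row.
pose b := \adj T *m d; pose g := rVpoly b^T.
have vg : \det T *: v^T = horner_mx A g *m e.
  rewrite horner_mx_rVpoly_krylov -walk_mx_krylov.
  apply: (@mulmx_inj_det _ _ W^T); first by rewrite det_tr.
  rewrite -scalemxAr def_d mulmxA walk_gram_diag -mulmxA [T *m _]mulmxA mul_mx_adj.
  by rewrite mul_scalar_mx scalemxAr.
exists g => //.
pose chi := char_poly A; have chi_mon : chi \is monic := char_poly_monic A.
pose r := Pdiv.Ring.rmodp (g ^+ 2) chi; pose q := Pdiv.Ring.rdivp (g ^+ 2) chi.
have def_r : g ^+ 2 = q * chi + r by apply: Pdiv.RingMonic.rdivp_eq.
have sz_r : (size r <= n.+1)%N.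
  by rewrite -ltnS -(size_char_poly A) Pdiv.Ring.ltn_rmodp monic_neq0.
have rA : horner_mx A r = horner_mx A g *m horner_mx A g.
  rewrite mulmxE -expr2 -rmorphXn /= def_r rmorphD rmorphM /= Cayley_Hamilton.
  by rewrite mulr0 add0r.
have r2 : forall i (j : 'I_1), (2 %| ((\col_i r`_i : 'cV_n.+1) i j)%R)%Z.
  apply: walk_solve => i j; rewrite ord1 -mulmxA walk_mx_krylov krylov_mxM // rA.
  rewrite -mulmxA -vg; set x := _ *m (_ *: _).
  have -> : (W^T *m x) i 0 = (x^T *m W) 0 i by rewrite -[W in RHS]trmxK -trmx_mul [RHS]mxE.
  have -> : x^T = \det T *: (v *m horner_mx A g).
    rewrite trmx_mul (horner_mx_tr _ (adj_sym G)) linearZ /= trmxK.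
    by rewrite -scalemxAl.
  have -> : (\det T *: (v *m horner_mx A g) *m W) 0 i =
            \det T * (\det T * (v *m horner_mx A 'X^i *m v^T) 0 0).
    rewrite walk_mx_krylov mul_krylov_mxE -!scalemxAl [LHS]mxE; congr (_ * _).
    have -> : v *m horner_mx A g *m horner_mx A 'X^i *m e =
        v *m horner_mx A 'X^i *m (\det T *: v^T).
      rewrite vg !mulmxA -[v *m _ *m _]mulmxA -[v *m _ *m _ in RHS]mulmxA.
      by rewrite [X in _ *m X *m _]comm_horner_mx2.
    by rewrite -scalemxAr [LHS]mxE.
  by do 2! apply: dvdz_mull.
have r0 : map_poly intr r = 0 :> {poly 'F_2}.
  apply/polyP => i; rewrite coef_map coef0 /=; apply/eqP; rewrite intr_Fp_eq0 //.
  case: (ltnP i n.+1) => [lt_i | le_i].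
    by have := r2 (Ordinal lt_i) 0; rewrite mxE.
  by rewrite nth_default ?dvdz0 // (leq_trans sz_r).
by rewrite -rmorphXn /= def_r rmorphD rmorphM /= r0 addr0 dvdp_mull.
Qed.

Lemma walk_sum_even (r : {poly int}) :
  (odd n.+1 -> (2 %| r`_0)%Z) -> (2 %| ((e^T *m horner_mx A r *m e) 0 0)%R)%Z.
Proof.
move=> r0; rewrite (horner_mx_sum _ (leqnn _)) mulmx_sumr mulmx_suml summxE.
apply: rpred_sum => k _; rewrite -scalemxAr -scalemxAl mxE -mulmxA.
have -> : (e^T *m (A ^+ k *m e)) 0 0 = \sum_i (A ^+ k *m e) i 0.
  by rewrite mxE; apply: eq_bigr => i _; rewrite !mxE mul1r.
have [k0 | k_gt0] := posnP k; last by apply: dvdz_mull; apply: walks_even.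
rewrite k0 expr0 mul1mx; under eq_bigr do rewrite mxE.
rewrite sumr_const card_ord.
have [odd_n | even_n] := boolP (odd n.+1); first by apply: dvdz_mulr; apply: r0.
by apply: dvdz_mull; rewrite dvdzE dvdn2 natz.
Qed.

(* With [v = g(A) e] and [w = h(A) e] up to the odd factor [det T], both squares
   [g ^ 2] and [h ^ 2] are divisible by the characteristic polynomial modulo 2,
   and so is the product [g h], since that polynomial is [P ^ 2] or [X P ^ 2]. *)
Lemma walk_isotropic_even (v w : 'rV[int]_n.+1) :
    (forall g, (2 %| ((v *m horner_mx A g *m e) 0 0)%R)%Z) ->
    (forall g, (4 %| ((v *m horner_mx A g *m v^T) 0 0)%R)%Z) ->
    (forall g, (2 %| ((w *m horner_mx A g *m e) 0 0)%R)%Z) ->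
    (forall g, (4 %| ((w *m horner_mx A g *m w^T) 0 0)%R)%Z) ->
  (4 %| ((v *m w^T) 0 0)%R)%Z.
Proof.
move=> ve vv we ww.
have [g vg chi_g] := walk_generate ve vv.
have [h wh chi_h] := walk_generate we ww.
have [P def_chi] := char_poly_adj_F2 G; rewrite def_chi in chi_g chi_h.
set xi : {poly 'F_2} := if odd n.+1 then 'X else 1.
have P0 : P != 0.
  have : (map_poly intr (char_poly A) : {poly 'F_2}) != 0.
    by rewrite monic_neq0 // monic_map // char_poly_monic.
  by apply: contraNneq => P0; rewrite def_chi P0 expr0n mulr0.
have {}chi_g := dvdp_sqr_cofactor P0 chi_g.
have {}chi_h := dvdp_sqr_cofactor P0 chi_h.
have [s def_gh] : exists s, map_poly intr (g * h) = s * (xi * P) ^+ 2.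
  by apply/dvdpP; rewrite expr2 rmorphM dvdp_mul.
pose xiZ : {poly int} := if odd n.+1 then 'X else 1.
have [r def_r] : exists r, g * h - xiZ * char_poly A * lift_poly s = 2%:P * r.
  apply: (@polyFp_eq0 2) => //; rewrite rmorphB !rmorphM /= lift_polyK // def_chi.
  have -> : map_poly intr xiZ = xi by rewrite /xiZ /xi; case: ifP; rewrite ?map_polyX ?rmorph1.
  by rewrite -/xi -rmorphM /= def_gh; ring.
(* In odd order e^T e is odd, so the constant term of [r] has to be even. Here X divides both [g]
   and [h] modulo 2, so 4 divides the constant term of g h, while the factor [xiZ] has none. *)
have r0 : odd n.+1 -> (2 %| r`_0)%Z.
  move=> odd_n.
  have coef0_even (q : {poly int}) : xi * P %| map_poly intr q -> (2 %| q`_0)%Z.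
    rewrite /xi odd_n => /(dvdp_trans (dvdp_mulr P (dvdpp 'X))) => /dvdpP[t def_t].
    rewrite -(@intr_Fp_eq0 2) // -[_%:~R]/((intr : int -> 'F_2) _) -coef_map def_t.
    by rewrite coefMX.
  have : (2 * 2 %| (2 * r`_0)%R)%Z.
    rewrite -coefCM -def_r coefB coefM big_ord_recl big_ord0 addr0 /=.
    rewrite rpredB //; first by apply: dvdz_mul; apply: coef0_even.
    by rewrite /xiZ odd_n -mulrA mulrC coefMX eqxx dvdz0.
  by rewrite dvdz_mul2l.
have : (4 %| (\det T * (\det T * (v *m w^T) 0 0))%R)%Z.
  have -> : \det T * (\det T * (v *m w^T) 0 0) =
      ((\det T *: v^T)^T *m (\det T *: w^T)) 0 0.
    rewrite -scalemxAr [(_ *: v^T)^T]linearZ /= trmxK -scalemxAl [RHS]mxE.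
    by congr (_ * _); rewrite [RHS]mxE.
  rewrite vg wh trmx_mul (horner_mx_tr _ (adj_sym G)) mulmxA -[_ *m _ *m horner_mx A h]mulmxA.
  rewrite mulmxE -rmorphM /=.
  have -> : g * h = xiZ * lift_poly s * char_poly A + 2%:P * r by rewrite -def_r; ring.
  rewrite rmorphD !rmorphM /= Cayley_Hamilton mulr0 add0r horner_mx_C.
  rewrite -mulmxE mul_scalar_mx -scalemxAr -scalemxAl mxE.
  by apply: (@dvdz_mul 2 2 2) => //; apply: walk_sum_even.
have co4 : coprimez 4 (\det T).
  by rewrite coprimezE (coprimeXl 2 (m := 2)) // prime_coprime //.
by rewrite !Gauss_dvdzr.
Qed.

(** Every vector 2 u satisfies both conditions, so 4 divides 2 v u^T for all u. *)
Lemma map_mx_F2_eq0 (v : 'rV[int]_n.+1) :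
    (forall g, (2 %| ((v *m horner_mx A g *m e) 0 0)%R)%Z) ->
    (forall g, (4 %| ((v *m horner_mx A g *m v^T) 0 0)%R)%Z) ->
  map_mx intr v = 0 :> 'rV['F_2]_n.+1.
Proof.
move=> ve vv; apply/rowP => j; rewrite !mxE; apply/eqP; rewrite intr_Fp_eq0 //.
have : forall u : 'rV[int]_n.+1,
    (4 %| ((v *m (2 *: u)^T) 0 0)%R)%Z.
  move=> u; apply: walk_isotropic_even => // g; rewrite -!scalemxAl mxE.
    exact: dvdz_mulr.
  by rewrite linearZ /= -scalemxAr mxE mulrA; apply: dvdz_mulr.
move/(_ (delta_mx 0 j)); rewrite linearZ /= -scalemxAr mxE trmx_delta.
by rewrite -colE mxE (dvdz_mul2l (p := 2) (d := 2)).
Qed.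

End TwoAdic.

(** * The rational orthogonal matrix *)

Lemma char_poly_eq_spectrum n (M N : 'M[int]_n) :
  perm_eq (spectrum M) (spectrum N) -> char_poly M = char_poly N.
Proof.
move=> eqMN; apply: (map_inj_poly (f := (intr : int -> algC))) => //.
  exact: intr_inj.
by rewrite !map_char_poly !char_poly_spectrum; apply: perm_big.
Qed.

Lemma adj_complement n (G : sgraph n) :
  adj (complement G) = allone n - 1%:M - adj G.
Proof.
apply/matrixP => i j; rewrite !mxE /= /compl_rel.
by case: eqVneq => [->|_]; rewrite ?edge_irr //=; case: (G i j).
Qed.

(** Translates the spectrum of the complement into a statement on A - J, a rank-one change of A. *)
Lemma char_poly_complement n (J M : 'M[int]_n) :
  char_poly (M - J) = (-1) ^+ n *: (char_poly (J - 1%:M - M) \Po (-1 - 'X)).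
Proof.
rewrite /char_poly -(det_map_mx (comp_poly (-1 - 'X))).
have -> : map_mx (comp_poly (-1 - 'X)) (char_poly_mx (J - 1%:M - M)) =
    -1 *: char_poly_mx (M - J).
  apply/matrixP => i j; rewrite !mxE comp_polyB comp_polyC rmorphMn /= comp_polyX.
  case: (i == j); rewrite ?mulr1n ?mulr0n !polyCB ?polyC1 ?polyC0; ring.
by rewrite detZ -mul_polyC rmorphXn /= polyCN mulrA -exprMn mulrNN mul1r expr1n mul1r.
Qed.

(** Two column eliminations of the bordered matrix [N]; the second is cleared of denominators and
    costs a factor [\det M], cancelled at the end. *)
Lemma det_rank1_update (R : idomainType) n (M : 'M[R]_n) (u : 'cV_n) (v : 'rV_n) :
  \det M != 0 -> \det (M + u *m v) = \det M + (v *m \adj M *m u) 0 0.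
Proof.
move=> M0; set d := \det M in M0 *; set s := (v *m \adj M *m u) 0 0.
pose N : 'M[R]_(n + 1) := block_mx M u (- v) 1%:M.
have det_N : \det N = \det (M + u *m v).
  have e1 : N *m block_mx 1%:M 0 v 1%:M = block_mx (M + u *m v) u 0 1%:M.
    by rewrite mulmx_block !mulmx1 !mulmx0 !mul1mx !add0r addNr.
  have := congr1 determinant e1.
  by rewrite det_mulmx det_lblock det_ublock !det1 !mulr1.
have e2 : N *m block_mx 1%:M (- (\adj M *m u)) 0 d%:M = block_mx M 0 (- v) (d + s)%:M.
  rewrite mulmx_block !mulmx1 !mulmx0 !mul1mx !addr0 mulmxN mulmxA mul_mx_adj.
  rewrite mul_scalar_mx mul_mx_scalar addNr mulNmx mulmxN opprK mulmxA.
  by congr (block_mx _ _ _ _); rewrite [_ *m u]mx11_scalar -/s addrC raddfD.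
apply: (mulIf M0); rewrite -det_N.
have := congr1 determinant e2.
rewrite det_mulmx det_ublock det_lblock !det_scalar expr1n !expr1 mul1r => ->.
by rewrite mulrC.
Qed.

(** * Walk counts and the orthogonal matrix *)

Lemma size_sum_leq (R : nzRingType) m k (F : 'I_m -> {poly R}) :
  (forall i, (size (F i) <= k)%N) -> (size (\sum_i F i)%R <= k)%N.
Proof.
move=> szF; apply: leq_trans (size_sum _ _ _) _.
by apply/bigmax_leqP => i _.
Qed.

Lemma size_det_leq (R : comNzRingType) n (M : 'M[{poly R}]_n) :
  (forall i j, (size (M i j) <= 2)%N) -> (size (\det M)%R <= n.+1)%N.
Proof.
move=> szM; apply: (big_ind (fun q : {poly R} => size q <= n.+1)%N).
- by rewrite size_poly0.
- by move=> p q sp sq; rewrite (leq_trans (size_polyD _ _)) // geq_max sp.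
move=> s _; rewrite size_Msign (leq_trans (size_prod_leq _ _)) //.
rewrite leq_subLR card_ord addnS ltnS addnn.
rewrite -muln2; apply: leq_trans (leq_sum (E2 := fun=> 2%N) _ _) _ => //.
by rewrite sum_nat_const card_ord.
Qed.

Section WalkSeries.
Variables (n : nat) (A : 'M[int]_n.+1).
Local Notation e := (const_mx 1 : 'cV[int]_n.+1).
Local Notation X := (char_poly_mx A).

Definition walk_count k : int := (e^T *m A ^+ k *m e) 0 0.
(** Divided by the characteristic polynomial, this is the generating series in 1/t of the walk
    counts from index [k] on, starting with the coefficient of 1/t. *)
Definition walk_numer k : {poly int} :=
  (map_mx polyC (e^T *m A ^+ k) *m \adj X *m map_mx polyC e) 0 0.

Lemma size_walk_numer k : (size (walk_numer k) <= n.+1)%N.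
Proof.
rewrite /walk_numer mxE; apply: size_sum_leq => j.
rewrite mxE mulrC [map_mx _ _ _ _]mxE mul_polyC (leq_trans (size_scale_leq _ _)) //.
apply: size_sum_leq => i; rewrite [map_mx _ _ _ _]mxE mul_polyC.
rewrite (leq_trans (size_scale_leq _ _)) // mxE /cofactor.
rewrite size_Msign.
apply: size_det_leq => a b; rewrite !mxE.
rewrite (leq_trans (size_polyD _ _)) // geq_max size_polyN.
rewrite (leq_trans (size_polyC_leq1 _)) // andbT.
by case: (_ == _); rewrite ?mulr1n ?size_polyX // mulr0n size_poly0.
Qed.

Lemma walk_numerS k :
  walk_numer k.+1 = 'X * walk_numer k - (walk_count k)%:P * char_poly A.
Proof.
have XA : map_mx polyC A *m \adj X = 'X *: \adj X - (char_poly A)%:M.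
  rewrite -[(char_poly A)%:M]mul_mx_adj mulmxBl mul_scalar_mx.
  by rewrite opprB addrC subrK.
rewrite /walk_numer exprSr -mulmxE [e^T *m (_ *m A)]mulmxA map_mxM -[_ *m _ *m \adj X]mulmxA XA.
rewrite mulmxBr mulmxBl -scalemxAr -scalemxAl 2!mxE; congr (_ + _).
rewrite mul_mx_scalar -scalemxAl 2!mxE -map_mxM mxE mulrC.
by rewrite /walk_count.
Qed.

Lemma walk_countE k : walk_count k = (walk_numer k)`_n.
Proof.
have /(congr1 (fun q : {poly int} => q`_n.+1)) := walk_numerS k.
rewrite nth_default ?size_walk_numer // coefB coefXM coefCM /=.
have -> : (char_poly A)`_n.+1 = 1.
  by have /monicP := char_poly_monic A; rewrite lead_coefE size_char_poly.
by rewrite mulr1 => /esym/eqP; rewrite subr_eq0 => /eqP.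
Qed.

Lemma char_poly_sub_allone :
  char_poly (A - allone n.+1) = char_poly A + walk_numer 0.
Proof.
have -> : char_poly (A - allone n.+1) =
    \det (X + map_mx polyC e *m map_mx polyC e^T).
  congr (\det _); apply/matrixP => i j.
  rewrite !mxE big_ord1 !mxE polyCB; ring.
rewrite det_rank1_update ?monic_neq0 ?char_poly_monic //.
by rewrite /walk_numer expr0 mulmx1.
Qed.

End WalkSeries.

(** The first numerator is the difference of the two characteristic polynomials. Each count is read
    off the top coefficient of a numerator and determines the next one. *)
Lemma walk_count_eq n (A B : 'M[int]_n.+1) :
    char_poly A = char_poly B ->
    char_poly (A - allone n.+1) = char_poly (B - allone n.+1) ->
  walk_count A =1 walk_count B.
Proof.
move=> chiAB; rewrite !char_poly_sub_allone chiAB => /addrI num0.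
have numk k : walk_numer A k = walk_numer B k.
  elim: k => [|k IH]; first exact: num0.
  by rewrite (walk_numerS A) (walk_numerS B) (walk_countE A) (walk_countE B) IH chiAB.
by move=> k; rewrite !walk_countE numk.
Qed.

(** [O] is WB WA^-1, written through transposes by equality of the Gram matrices. Intertwining on
    the last column involves the power [n.+1], which the common characteristic polynomial
    reduces. *)
Lemma orthogonal_intertwiner n (A B : 'M[rat]_n.+1) (e : 'cV_n.+1) :
    char_poly A = char_poly B ->
    (krylov_mx A e)^T *m krylov_mx A e = (krylov_mx B e)^T *m krylov_mx B e ->
    \det (krylov_mx A e) != 0 ->
  exists O : 'M_n.+1, [/\ O *m O^T = 1%:M, O *m A = B *m O & O *m e = e].
Proof.
move=> chiAB gram detA; set WA := krylov_mx A e in gram detA *; set WB := krylov_mx B e in gram *.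
have uA : WA \in unitmx by rewrite unitmxE unitfE.
have uB : WB \in unitmx.
  rewrite unitmxE unitfE; have /(congr1 determinant) := gram.
  rewrite !det_mulmx !det_tr => e2; apply: contraNneq detA => B0.
  by move/eqP: e2; rewrite B0 mul0r mulf_eq0 orbb.
have uBT : WB^T \in unitmx by rewrite unitmx_tr.
pose O := invmx WB^T *m WA^T.
have OO : O *m O^T = 1%:M.
  rewrite /O trmx_mul trmxK trmx_inv trmxK mulmxA -[_ *m _ *m WA]mulmxA gram.
  by rewrite mulKmx // mulmxV.
have OW : O *m WA = WB by rewrite /O -mulmxA gram mulKmx.
clearbody O; have Oge g : O *m (horner_mx A g *m e) = horner_mx B g *m e.
  have red (M : 'M[rat]_n.+1) : horner_mx M g = horner_mx M (g %% char_poly M).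
    rewrite {1}(divp_eq g (char_poly M)) rmorphD rmorphM /= Cayley_Hamilton.
    by rewrite mulr0 add0r.
  have sz : (size (g %% char_poly A)%R <= n.+1)%N.
    by rewrite -ltnS -(size_char_poly A) ltn_modp monic_neq0 ?char_poly_monic.
  rewrite red [in RHS]red -chiAB -!krylov_mxM //.
  by rewrite mulmxA -/WA OW.
exists O; split=> //.
- apply: (row_free_inj (A := WA)); first by rewrite row_free_unit.
  have colW (M : 'M_n.+1) j : col j (krylov_mx M e) = horner_mx M 'X^j *m e.
    by apply/colP => i; rewrite rmorphXn /= horner_mx_X !mxE.
  apply/matrixP => i j; rewrite -[B *m O *m WA]mulmxA OW -[O *m A *m WA]mulmxA.
  suff : col j (O *m (A *m WA)) = col j (B *m WB) by move/colP/(_ i); rewrite ![col _ _ _ _]mxE.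
  rewrite !colE -!mulmxA -!colE !colW.
  have mulX (M : 'M[rat]_n.+1) : M *m (horner_mx M 'X^j *m e) = horner_mx M 'X^(j.+1) *m e.
    by rewrite exprS rmorphM /= horner_mx_X -mulmxE mulmxA.
  by rewrite !mulX Oge.
- by have := Oge 1; rewrite !rmorph1 !mul1mx.
Qed.

(** * Vectors modulo p from a non-integral matrix *)

Lemma irreducible_factor (F : finFieldType) (f : {poly F}) : (1 < size f)%N ->
  exists phi, [/\ phi \is monic, irreducible_poly phi & phi %| f].
Proof.
have [k] := ubnP (size f); elim: k f => // k IH f /ltnSE le_fk f_gt1.
have f0 : f != 0 by rewrite -size_poly_gt0 ltnW.
have [f_irr | ] := irreducibleP f.
  have c0 : (lead_coef f)^-1 != 0 by rewrite invr_eq0 lead_coef_eq0.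
  exists ((lead_coef f)^-1 *: f); split.
  - by rewrite monicE lead_coefZ mulVf // lead_coef_eq0.
  - split; first by rewrite size_scale.
    move=> q q1; rewrite dvdpZr // => /(apply_irredp f_irr q1)/eqp_trans; apply.
    by rewrite eqp_sym eqp_scale.
  - by rewrite dvdpZl.
move/irreducibleP; rewrite /irreducibleb f_gt1 /= negb_forall => /existsP[q].
rewrite negb_imply -ltnNge -dvdpE => /andP[q_f q_gt1].
have [|phi [phi_mon phi_irr phi_q]] := IH q _ q_gt1.
  rewrite (leq_trans _ le_fk) // (leq_ltn_trans (size_npoly q)) //.
  by rewrite prednK // ltnW.
by exists phi; split=> //; apply: dvdp_trans q_f.
Qed.

(** Irreducible factors are stripped from a polynomial killing [v] until the cofactor no longer
    kills it. *)
Lemma irreducible_annihilator (F : finFieldType) n (A : 'M[F]_n.+1) (v : 'rV_n.+1) :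
  v != 0 -> exists (g phi : {poly F}), [/\ phi \is monic, irreducible_poly phi,
    v *m horner_mx A g != 0 & v *m horner_mx A g *m horner_mx A phi = 0].
Proof.
move=> v0; have : v *m horner_mx A (char_poly A) = 0 by rewrite Cayley_Hamilton mulmx0.
have : char_poly A != 0 by rewrite monic_neq0 ?char_poly_monic.
move: (char_poly A) => f; have [k] := ubnP (size f).
elim: k f => // k IH f /ltnSE le_fk f0 vf.
have [f_gt1 | f_le1] := ltnP 1 (size f); last first.
  move: vf f0; rewrite (size1_polyC f_le1) horner_mx_C mul_mx_scalar polyC_eq0.
  by move/eqP; rewrite scaler_eq0 (negPf v0) orbF => ->.
have [phi [phi_mon phi_irr /dvdpP[g def_f]]] := irreducible_factor f_gt1.
have g0 : g != 0 by apply: contraNneq f0 => g0; rewrite def_f g0 mul0r.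
have [vg | vg] := eqVneq (v *m horner_mx A g) 0; last first.
  exists g, phi; split=> //.
  by rewrite -mulmxA mulmxE -rmorphM /= -def_f.
apply: (IH g) => //; rewrite (leq_trans _ le_fk) // def_f size_Mmonic //.
have [phi_gt1 _] := phi_irr; case: (size phi) phi_gt1 => [|[|s]] // _.
by rewrite !addnS /= ltnS leq_addr.
Qed.

(** With [D] the least common denominator of row [i] and [p] a prime factor of it, [v] is [D] times
    the row. Were it zero modulo [p], already D / p would clear the denominators. *)
Lemma nonintegral_row n (O : 'M[rat]_n) i j : O i j \isn't a Num.int ->
  exists p, prime p /\ exists z v : 'rV[int]_n,
    map_mx intr v = p%:R *: (map_mx intr z *m O) /\ map_mx intr v != 0 :> 'rV['F_p]_n.
Proof.
move=> Oij; pose P D := (0 < D)%N && [forall k, D%:R * O i k \is a Num.int].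
have exP : exists D, P D.
  exists (\prod_k `|denq (O i k)|)%N; apply/andP; split.
    by rewrite prodn_gt0 // => k; rewrite absz_gt0 denq_neq0.
  apply/forallP => k; rewrite (bigD1 k) //= natrM mulrAC rpredM ?rpred_nat //.
  have -> : `|denq (O i k)|%:R = (denq (O i k))%:~R :> rat.
    by rewrite -[in RHS](gez0_abs (m := denq (O i k))) // -pmulrn.
  by rewrite mulrC -numqE rpred_int.
have [D /andP[D_gt0 /forallP intD] minD] := ex_minnP exP.
have D_gt1 : (1 < D)%N.
  rewrite ltn_neqAle D_gt0 andbT; apply: contraNneq Oij => D1.
  by have := intD j; rewrite -D1 mul1r.
exists (pdiv D); split; first exact: pdiv_prime.
have p_pr := pdiv_prime D_gt1; set p := pdiv D in p_pr *.
have def_D : D = (p * (D %/ p))%N by rewrite mulnC divnK // pdiv_dvd.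
exists (\row_k if k == i then (D %/ p)%N%:Z else 0), (\row_k numq (D%:R * O i k)).
have zO k : ((map_mx intr (\row_k if k == i then (D %/ p)%N%:Z else 0) : 'rV[rat]_n) *m O) 0 k =
    (D %/ p)%:R * O i k.
  rewrite mxE (bigD1 i) //= big1 ?addr0 => [|l /negPf li]; rewrite !mxE ?eqxx ?pmulrn //.
  by rewrite li mul0r.
split.
  apply/rowP => k; rewrite [RHS]mxE zO !mxE mulrA -natrM -def_D.
  by have /intrP[m ->] := intD k; rewrite numq_int.
apply/eqP => v0; have [w def_w] := mxFp_eq0 p_pr v0.
have : P (D %/ p)%N.
  rewrite /P divn_gt0 ?prime_gt0 // dvdn_leq ?pdiv_dvd //=.
  apply/forallP => k; have /rowP/(_ k) := def_w; rewrite !mxE.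
  have /intrP[m def_m] := intD k; rewrite def_m numq_int => def_mw.
  have p0 : p%:R != 0 :> rat by rewrite pnatr_eq0 -lt0n prime_gt0.
  have -> : (D %/ p)%:R * O i k = (w 0 k)%:~R.
    apply: (mulfI p0); rewrite mulrA -natrM -def_D def_m def_mw intrM.
    by rewrite -pmulrn.
  exact: rpred_int.
by move/minD; rewrite leqNgt ltn_Pdiv // prime_gt1.
Qed.

Lemma lift_poly_monic p (phi : {poly 'F_p}) : prime p -> phi \is monic ->
  lift_poly phi \is monic /\ size (lift_poly phi) = size phi.
Proof.
move=> p_pr phi_mon.
have one1 : Posz (nat_of_ord (1 : 'F_p)) = 1.
  by rewrite /= modn_small // Fp_cast ?prime_gt1.
have sz : size (lift_poly phi) = size phi.
  by rewrite size_map_poly_id0 // (monicP phi_mon) one1.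
split=> //; rewrite monicE lead_coefE sz coef_map_id0 // -lead_coefE.
Qed.

(** In each row the entries and their squares both sum to 1, while x^2 - x is nonnegative on
    integers: every entry is 0 or 1, and [P] is a permutation matrix. *)
Lemma orthogonal_int_isomorphic n (H G : sgraph n) (P : 'M[int]_n) :
    P *m P^T = 1%:M -> P *m (const_mx 1 : 'cV_n) = const_mx 1 ->
    P *m adj G = adj H *m P -> isomorphic H G.
Proof.
move=> PP Pe PA.
have sum1 i : \sum_j P i j = 1.
  have /colP/(_ i) := Pe; rewrite !mxE => <-.
  by apply: eq_bigr => j _; rewrite mxE mulr1.
have sumsq i : \sum_j P i j ^+ 2 = 1.
  have /matrixP/(_ i i) := PP; rewrite !mxE eqxx => PPi; rewrite -[RHS]/(true%:R) -PPi.
  by apply: eq_bigr => j _; rewrite mxE expr2.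
have sqr_ge (x : int) : 0 <= x ^+ 2 - x.
  rewrite subr_ge0; have [x0 | x0] := lerP x 0.
    by rewrite (le_trans x0) // sqr_ge0.
  by rewrite expr2 ler_peMr // ltW.
have P01 i j : P i j ^+ 2 - P i j = 0.
  have : \sum_k (P i k ^+ 2 - P i k) = 0 by rewrite sumrB sumsq sum1 subrr.
  by move/eqP; rewrite psumr_eq0 // => /allP/(_ j (mem_index_enum j))/eqP.
have P_bool i j : P i j = (P i j == 1)%:R.
  have /eqP := P01 i j; rewrite expr2 -{3}[P i j]mulr1 -mulrBr mulf_eq0 subr_eq0.
  by case/orP => [/eqP->|/eqP->]; rewrite ?eqxx.
have ex_one i : exists j, P i j == 1.
  apply/existsP; apply: contra_eqT (sum1 i); rewrite negb_exists => /forallP Pi.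
  by rewrite big1 // => j _; rewrite P_bool (negPf (Pi j)).
pose f i := xchoose (ex_one i).
have Pf i j : P i j = (j == f i)%:R.
  have /eqP Pfi : P i (f i) == 1 := xchooseP (ex_one i).
  case: eqVneq => [->|ji] //.
  have := sum1 i; rewrite (bigD1 (f i)) //= Pfi => /eqP.
  rewrite -subr_eq0 addrAC subrr add0r psumr_eq0 => [/allP/(_ j)|k _].
    by rewrite mem_index_enum ji => /(_ isT)/eqP.
  by rewrite P_bool ler0n.
have f_inj : injective f.
  move=> i k fik; have /matrixP/(_ i k) := PP; rewrite !mxE.
  rewrite (bigD1 (f i)) //= big1 => [|j /negPf jf]; last by rewrite Pf jf mul0r.
  rewrite mxE !Pf -fik eqxx mulr1 addr0.
  by case: eqVneq.
exists f; first exact: injF_bij.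
move=> i k; have /matrixP/(_ i (f k)) := PA; rewrite !mxE.
rewrite (bigD1 (f i)) //= big1 => [|j /negPf jf]; last by rewrite Pf jf mul0r.
rewrite [in RHS](bigD1 k) //= [in RHS]big1 => [|j /negPf jk]; last first.
  by rewrite Pf (inj_eq f_inj) eq_sym jk mulr0.
rewrite !Pf !eqxx !addr0 mul1r mulr1 !mxE.
by case: (G _ _); case: (H _ _).
Qed.

Section Level.
Variables (n : nat) (O : 'M[rat]_n.+1).
Hypothesis OO : O *m O^T = 1%:M.
Variable p : nat.

(* The integer vectors of [p L], where [L] is the lattice spanned by the rows
   of [O]. *)
Definition scaled_row_lattice (v : 'rV[int]_n.+1) :=
  exists z : 'rV[int]_n.+1, map_mx intr v = p%:R *: (map_mx intr z *m O).

Lemma scaled_row_lattice_dot v w : scaled_row_lattice v -> scaled_row_lattice w ->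
  ((p ^ 2)%N %| ((v *m w^T) 0 0)%R)%Z.
Proof.
case=> z vz [y wy]; apply/dvdzP; exists ((z *m y^T) 0 0).
apply: (@intr_inj rat); rewrite rmorphM /=.
have -> : ((v *m w^T) 0 0)%:~R = (map_mx intr (v *m w^T) : 'M[rat]_1) 0 0 by rewrite [RHS]mxE.
have -> : ((z *m y^T) 0 0)%:~R = (map_mx intr (z *m y^T) : 'M[rat]_1) 0 0 by rewrite [RHS]mxE.
rewrite !map_mxM -!map_trmx vz wy linearZ /= trmx_mul -scalemxAr -scalemxAl.
rewrite [_ *m O *m _]mulmxA -[_ *m O *m O^T]mulmxA OO mulmx1 scalerA mxE.
by rewrite mulrC -natrM mulnn -pmulrn.
Qed.

Lemma scaled_row_lattice_horner (M M' : 'M[int]_n.+1) v g :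
    O *m map_mx intr M = map_mx intr M' *m O ->
  scaled_row_lattice v -> scaled_row_lattice (v *m horner_mx M g).
Proof.
move=> OM [z vz]; exists (z *m horner_mx M' g).
rewrite !map_mxM vz -scalemxAl; congr (_ *: _); rewrite -!mulmxA; congr (_ *m _).
rewrite !map_horner_mx; move: (map_poly _ g) => {}g.
elim/poly_ind: g => [|g c IH]; first by rewrite !rmorph0 mulmx0 mul0mx.
rewrite !rmorphD !rmorphM /= !horner_mx_X !horner_mx_C mulmxDr mulmxDl -!mulmxE.
by rewrite mulmxA IH -!mulmxA OM scalar_mxC.
Qed.

Lemma scaled_row_lattice_sum v :
    O *m (const_mx 1 : 'cV_n.+1) = const_mx 1 -> scaled_row_lattice v ->
  (p %| ((v *m (const_mx 1 : 'cV_n.+1)) 0 0)%R)%Z.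
Proof.
move=> Oe [z vz]; apply/dvdzP; exists ((z *m (const_mx 1 : 'cV_n.+1)) 0 0).
apply: (@intr_inj rat); rewrite rmorphM /=.
pose e1 := map_const_mx (intr : int -> rat) n.+1 1 1.
have -> : ((v *m (const_mx 1 : 'cV_n.+1)) 0 0)%:~R =
  (map_mx intr (v *m (const_mx 1 : 'cV_n.+1)) : 'M[rat]_1) 0 0 by rewrite [RHS]mxE.
have -> : ((z *m (const_mx 1 : 'cV_n.+1)) 0 0)%:~R =
  (map_mx intr (z *m (const_mx 1 : 'cV_n.+1)) : 'M[rat]_1) 0 0 by rewrite [RHS]mxE.
rewrite !map_mxM vz e1 -scalemxAl -mulmxA Oe mxE mulrC.
by rewrite -pmulrn.
Qed.

End Level.

Lemma horner_mx_add_annihilated (R : comNzRingType) n (A J : 'M[R]_n.+1) (v : 'rV_n.+1) :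
    (forall g, v *m horner_mx A g *m J = 0) ->
  forall g, v *m horner_mx (A + J) g = v *m horner_mx A g.
Proof.
move=> vJ; elim/poly_ind => [|g c IH]; first by rewrite !rmorph0.
rewrite !rmorphD !rmorphM /= !horner_mx_X !horner_mx_C !mulmxDr -!mulmxE !mulmxA IH.
by rewrite mulmxDr vJ addr0.
Qed.

Lemma allone_mul n : allone n = (const_mx 1 : 'cV[int]_n) *m (const_mx 1 : 'rV_n).
Proof. by apply/matrixP => i j; rewrite !mxE big_ord1 !mxE mulr1. Qed.

Lemma exists_annihilated_vector n (G : sgraph n.+1) (B : 'M[int]_n.+1) (O : 'M[rat]_n.+1) p
    (v : 'rV[int]_n.+1) :
    prime p -> O *m O^T = 1%:M -> O *m (const_mx 1 : 'cV_n.+1) = const_mx 1 ->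
    O *m map_mx intr (adj G) = map_mx intr B *m O ->
    scaled_row_lattice O p v -> map_mx intr v != 0 :> 'rV['F_p]_n.+1 ->
  exists (phi : {poly 'F_p}) (w : 'rV[int]_n.+1),
    [/\ phi \is monic, irreducible_poly phi, map_mx intr w != 0 :> 'rV['F_p]_n.+1,
        forall g, (p %| ((w *m horner_mx (adj G) g *m (const_mx 1 : 'cV_n.+1)) 0 0)%R)%Z &
        forall M, M = adj G \/ M = adj G + allone n.+1 ->
          (exists y, w *m horner_mx M (lift_poly phi) = p%:Z *: y) /\
          forall g, ((p ^ 2)%N %| ((w *m horner_mx M g *m w^T) 0 0)%R)%Z].
Proof.
move=> p_pr OO Oe OA Lv v0; set A := adj G in OA *; pose e : 'cV[int]_n.+1 := const_mx 1.
have [g [phi [phi_mon phi_irr vg0 vgphi]]] :=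
  irreducible_annihilator (map_mx intr A) v0.
pose w := v *m horner_mx A (lift_poly g).
have wE : map_mx intr w = map_mx intr v *m horner_mx (map_mx intr A) g :> 'rV['F_p]_n.+1.
  by rewrite map_mxM map_horner_mx lift_polyK.
have Lw : scaled_row_lattice O p w := scaled_row_lattice_horner _ OA Lv.
have we h : (p %| ((w *m horner_mx A h *m e) 0 0)%R)%Z.
  exact: scaled_row_lattice_sum Oe (scaled_row_lattice_horner _ OA Lw).
pose J := allone n.+1.
(* [O] fixes [e] on both sides, since its left and right inverses agree; hence it commutes with
   J. *)
have OJ : O *m map_mx intr J = map_mx intr J *m O.
  have eO : (const_mx 1 : 'rV_n.+1) *m O = const_mx 1.
    have <- : (const_mx 1 : 'cV[rat]_n.+1)^T = const_mx 1 by rewrite trmx_const.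
    by rewrite -{1}Oe trmx_mul -mulmxA (mulmx1C OO) mulmx1.
  by rewrite /J allone_mul map_mxM !map_const_mx mulmxA Oe -mulmxA eO.
exists phi, w; split=> //; first by rewrite wE.
move=> M def_M; split.
  apply: mxFp_eq0 => //; rewrite map_mxM map_horner_mx lift_polyK // wE.
  case: def_M => ->; first by [].
  rewrite map_mxD -wE horner_mx_add_annihilated ?wE // => h.
  rewrite -wE -(lift_polyK h) -map_horner_mx -!map_mxM allone_mul mulmxA.
  rewrite map_mxM [X in X *m _](_ : _ = 0) ?mul0mx //.
  by apply/matrixP => a b; rewrite mxE [RHS]mxE !ord1; apply/eqP; rewrite intr_Fp_eq0.
move=> h; refine (scaled_row_lattice_dot OO _ Lw).
case: def_M => ->; first exact: scaled_row_lattice_horner OA Lw.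
apply: (@scaled_row_lattice_horner _ _ _ _ (B + J)) Lw.
by rewrite !map_mxD mulmxDr mulmxDl OA OJ.
Qed.

(** * Comparison of orders at p and conclusion *)

Lemma ord_p_geq p m k : prime p -> ((p ^ k)%N %| m)%Z ->
  ord_p p m = None \/ exists2 l, ord_p p m = Some l & (k <= l)%N.
Proof.
move=> p_pr pm; rewrite /ord_p; case: eqVneq => [_|m0]; first by left.
right; exists (logn p `|m|) => //.
by move: pm; rewrite dvdzE /= pfactor_dvdn // absz_gt0.
Qed.

Lemma scaled_row_lattice_map_Fp_eq0 n (G : sgraph n.+1) (B : 'M[int]_n.+1) (O : 'M[rat]_n.+1) p
    (v : 'rV[int]_n.+1) :
    odd (theta G) ->
    ((p ^ 2 %| theta G)%N ->
      forall phi : {poly 'F_p},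
        phi \is monic -> irreducible_poly phi -> phi ^+ 2 %| Phi p G ->
        omin (ord_p p (\det (eval_mx (lift_poly phi) (adj G))))
             (ord_p p (\det (eval_mx (lift_poly phi) (adj G + allone n.+1))))
        = Some (size phi).-1) ->
    prime p -> O *m O^T = 1%:M -> O *m (const_mx 1 : 'cV_n.+1) = const_mx 1 ->
    O *m map_mx intr (adj G) = map_mx intr B *m O ->
    scaled_row_lattice O p v ->
  map_mx intr v = 0 :> 'rV['F_p]_n.+1.
Proof.
move=> odd_theta hphi p_pr OO Oe OA Lv; apply/eqP/negPn/negP => v0.
have [phi [w [phi_mon phi_irr w0 we wM]]] :=
  exists_annihilated_vector p_pr OO Oe OA Lv v0.
have [f_mon sz_f] := lift_poly_monic p_pr phi_mon.
have [phi_gt1 _] := phi_irr.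
have p0 : p%:Z != 0 by rewrite -lt0n prime_gt0.
set A := adj G in we wM *; set f := lift_poly phi in f_mon sz_f wM *.
have AT : A^T = A := adj_sym G.
have AJT : (A + allone n.+1)^T = A + allone n.+1 by rewrite linearD /= AT trmx_const.
have [[y wf] ww] := wM A (or_introl erefl).
have [[y' wf'] ww'] := wM _ (or_intror erefl).
have f_phi : map_poly intr f = phi := lift_polyK phi.
have chiA := char_poly_in_ideal_sqr p_pr AT f_mon f_phi phi_irr w0 wf ww.
have chiAJ := char_poly_in_ideal_sqr p_pr AJT f_mon f_phi phi_irr w0 wf' ww'.
have Delta_p : ((p ^ 2)%N %| discriminant G)%Z.
  have f_gt1 : (1 < size f)%N by rewrite sz_f.
  have [q [b [h [q_mon sz_fq def_chi]]]] :=
    in_ideal_sqr_monic p_pr f_mon f_gt1 (char_poly_monic A) f_phi chiA.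
  rewrite -natz natrX natz; apply: dvdz_discriminant p0 _ _ def_chi.
    by rewrite rpredM.
  by rewrite size_char_poly ltnS in sz_fq.
have p_odd : odd p.
  apply: contraLR odd_theta => even_p.
  have p2 : p = 2%N by case: (even_prime p_pr) => // odd_p; rewrite odd_p in even_p.
  subst p; rewrite -dvdn2 dvdn_gcd; apply/andP; split; last first.
    have : (2%N %| discriminant G)%Z by apply: dvdz_trans Delta_p.
    by rewrite dvdzE.
  suff : (2 %| reduced_det_walk G)%Z by rewrite dvdzE.
  by apply: contraT => odd_red; rewrite (map_mx_F2_eq0 odd_red we ww) eqxx in w0.
(* As [p] is odd, the removed power of 2 is prime to [p]. *)
have det_p : ((p ^ 2)%N %| reduced_det_walk G)%Z.
  have := dvdz_det_krylov p_pr AT w0 we ww.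
  rewrite -walk_mx_krylov -reduced_det_walkE Gauss_dvdzl //.
  rewrite coprimezE abszX /= coprimeXl // coprimeXr // coprimen2 //.
have theta_p : (p ^ 2 %| theta G)%N by rewrite dvdn_gcd; apply/andP; split.
have Phi_phi : phi ^+ 2 %| Phi p G.
  by rewrite dvdp_gcd !(dvdp_in_ideal_sqr p_pr f_phi).
have := hphi theta_p phi phi_mon phi_irr Phi_phi.
have detA := dvdz_det_horner p0 f_mon chiA.
have detAJ := dvdz_det_horner p0 f_mon chiAJ.
rewrite -!natz -natrX natz in detA detAJ.
rewrite !eval_mxE -/f; set d := (size phi).-1.
have d_gt0 : (0 < d)%N by rewrite /d; case: (size phi) phi_gt1 => [|[]].
have small k : (2 * (size f).-1 <= k)%N -> (d < k)%N.
  by apply: leq_trans; rewrite sz_f -/d mul2n -addnn -addn1 leq_add2l.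
(* Each order is infinite or at least 2 deg phi, which exceeds deg phi, so the minimum cannot be deg
   phi. *)
case: (ord_p_geq p_pr detA) => [->|[k -> /small dk]];
  case: (ord_p_geq p_pr detAJ) => [->|[l -> /small dl]] //= [].
- by move=> e; rewrite e ltnn in dl.
- by move=> e; rewrite e ltnn in dk.
- by move=> e; have := leq_min d.+1 k l; rewrite e ltnn dk dl.
Qed.

Lemma cospectral_intertwiner n (G H : sgraph n.+1) :
    controllable G -> same_generalized_spectrum H G ->
  exists O : 'M[rat]_n.+1, [/\ O *m O^T = 1%:M, O *m (const_mx 1 : 'cV_n.+1) = const_mx 1 &
    O *m map_mx intr (adj G) = map_mx intr (adj H) *m O].
Proof.
move=> G_ctrl /andP[/char_poly_eq_spectrum chi /char_poly_eq_spectrum chiC].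
have chiJ : char_poly (adj G - allone n.+1) = char_poly (adj H - allone n.+1).
  rewrite (char_poly_complement _ (adj G)) (char_poly_complement _ (adj H)).
  by rewrite -!adj_complement chiC.
have count := walk_count_eq (esym chi) chiJ.
have gram (K : sgraph n.+1) i j :
    ((walk_mx K)^T *m walk_mx K) i j = walk_count (adj K) (i + j).
  rewrite walk_gramE /walk_count -mulmxA mxE; apply: eq_bigr => l _.
  by rewrite !mxE mul1r.
have map_walk (K : sgraph n.+1) :
    krylov_mx (map_mx intr (adj K)) (const_mx 1) = map_mx intr (walk_mx K) :> 'M[rat]_n.+1.
  by rewrite walk_mx_krylov map_krylov_mx map_const_mx.
have [] := @orthogonal_intertwiner n (map_mx intr (adj G)) (map_mx intr (adj H)) (const_mx 1).
- by rewrite -!map_char_poly chi.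
- rewrite !map_walk !map_trmx -!map_mxM; congr map_mx.
  by apply/matrixP => i j; rewrite !gram count.
- by rewrite map_walk det_map_mx intr_eq0.
by move=> O [OO OA Oe]; exists O.
Qed.

Theorem theorem2 (n : nat) (G : sgraph n) (hG : controllable G)
    (htheta : odd (theta G))
    (hphi : forall p : nat, prime p -> (p ^ 2 %| theta G)%N ->
      forall phi : {poly 'F_p},
        phi \is monic -> irreducible_poly phi -> phi ^+ 2 %| Phi p G ->
        omin (ord_p p (\det (eval_mx (lift_poly phi) (adj G))))
             (ord_p p (\det (eval_mx (lift_poly phi) (adj G + allone n))))
        = Some (size phi).-1) :
  DGS G.
Proof.
move=> m H cospec.
have mn : m = n.
  by have /andP[/perm_size] := cospec; rewrite !size_spectrum.
subst m; case: n G hG htheta hphi H cospec => [|n] G hG htheta hphi H cospec.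
  by exists id; [exists id | case].
have [O [OO Oe OA]] := cospectral_intertwiner hG cospec.
have [intO | ] := boolP [forall i, forall j, O i j \is a Num.int].
  pose P := \matrix_(i, j) numq (O i j).
  have def_O : O = map_mx intr P.
    apply/matrixP => i j; rewrite !mxE.
    by have /forallP/(_ i)/forallP/(_ j)/intrP[k ->] := intO; rewrite numq_int.
  have inj k l : injective (map_mx intr : 'M[int]_(k, l) -> 'M[rat]_(k, l)).
    move=> M N /matrixP eqMN; apply/matrixP => i j; apply: (@intr_inj rat).
    by have := eqMN i j; rewrite !mxE.
  apply: (@orthogonal_int_isomorphic _ _ _ P); apply: inj.
  - by rewrite map_mxM -map_trmx -def_O OO map_mx1.
  - by rewrite map_mxM -def_O !map_const_mx Oe.
  - by rewrite !map_mxM -def_O OA.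
rewrite negb_forall => /existsP[i]; rewrite negb_forall => /existsP[j Oij].
have [p [p_pr [z [v [Lv v0]]]]] := nonintegral_row Oij.
rewrite (scaled_row_lattice_map_Fp_eq0 htheta (hphi p p_pr) p_pr OO Oe OA) ?eqxx // in v0.
by exists z.
Qed.
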